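(* Assume $A(x)=A\ge2$ for every $x\in\mathcal X$. Let $\delta\in(0,1)$ and $\iota=\log(3A_{\mathcal X}/\delta)$. Balanced-FTRL with the Shannon regularizer, IX parameters $\gamma_h=\sqrt{A^{H-h}\iota/(2A_{\mathcal X}T)}$ and learning rates $\eta_h=\sqrt{2A^{H-h}\log(A_{\mathcal X})/(A_{\mathcal X}T)}$, run against any (possibly adaptive) opponent sequence, satisfies with probability at least $1-\delta$ $$\mathrm{Reg}^T_{\max}\le\big(5\sqrt{\log(A_{\mathcal X})}+8\iota\big)\sqrt{A_{\mathcal X}T}.$$
   Context: Setting. An episodic two-player zero-sum imperfect-information game with horizon $H\in\mathbb N$ and perfect recall. The max-player's information sets form a finite set $\mathcal X=\bigsqcup_{h=1}^H\mathcal X_h$; each $x\in\mathcal X$ has a finite nonempty action set $\mathcal A(x)$ of size $A(x)$. Perfect recall: each $x_h\in\mathcal X_h$ has a unique history $(x_1,a_1,\dots,x_{h-1},a_{h-1},x_h)$. For $h<H$, $\mathcal X_{h+1}(x_h,a_h)$ is the (nonempty) set of $x_{h+1}\in\mathcal X_{h+1}$ whose history contains $(x_h,a_h)$. Write $x'\ge x$ if $x'=x$ or $x$ appears in the history of $x'$. $\mathcal A(\mathcal X_h)=\{(x_h,a_h):x_h\in\mathcal X_h,a_h\in\mathcal A(x_h)\}$, $A_{\mathcal X}=\sum_{x}A(x)$. A policy $\mu=(\mu_h(\cdot|x_h))$ assigns distributions on $\mathcal A(x_h)$; $\Pi_{\max}$ is the set of policies; realization plan $\mu_{1:h}(x_h,a_h)=\prod_{h'\le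 h}\mu_{h'}(a_{h'}|x_{h'})$ along the history. For a min-player policy $\nu$, $p^\nu_0$ (distribution on $\mathcal X_1$), $p^\nu_h(\cdot|x_h,a_h)$ (distribution on $\mathcal X_{h+1}(x_h,a_h)$) and $r^\nu_h(x_h,a_h)\in[0,1]$ are the induced transitions and expected rewards; $p^\nu_{1:h}(x_h)=p^\nu_0(x_1)\prod_{h'<h}p^\nu_{h'}(x_{h'+1}|x_{h'},a_{h'})$; $\ell^\nu_h(x_h,a_h)=p^\nu_{1:h}(x_h)(1-r^\nu_h(x_h,a_h))$; $\langle\mu_{1:},\ell\rangle=\sum_h\sum_{(x_h,a_h)}\mu_{1:h}(x_h,a_h)\ell_h(x_h,a_h)$. Protocol: $T$ episodes; $\mu^t,\nu^t$ are $\mathcal F_{t-1}$-measurable ($\mathcal F_t$ generated by observations of episodes $\le t$ and $\nu^{t+1}$); in episode $t$ the max-player observes $x^t_h$, plays $a^t_h\sim\mu^t_h(\cdot|x^t_h)$, receives $r^t_h\in[0,1]$, with conditional law $\Pr(x^t_h=x_h,a^t_h=a_h|\mathcal F_{t-1})=p^{\nu^t}_{1:h}(x_h)\mu^t_{1:h}(x_h,a_h)$ and $\mathbb E[\mathbb 1\{x^t_h=x_h,a^t_h=a_h\}(1-r^t_h)|\mathcal F_{t-1}]=\mu^t_{1:h}(x_h,a_h)\ell^{\nu^t}_h(x_h,a_h)$. Regret $\mathrm{Reg}^T_{\max}=\max_{\mu^\dagger}\sum_t\langle\mu^t_{1:}-\mu^\dagger_{1:},\ell^{\nu^t}\rangle$.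 Balanced transitions: $A^\tau(x)=\sum_{x'\ge x}A(x')$, $p^\star_0(x_1)=A^\tau(x_1)/A_{\mathcal X}$, $p^\star_h(x_{h+1}|x_h,a_h)=A^\tau(x_{h+1})/\sum_{x'\in\mathcal X_{h+1}(x_h,a_h)}A^\tau(x')$, $p^\star_{1:h}$ the product along the history. Balanced-FTRL (Shannon) with parameters $\eta_h,\gamma_h>0$: $\tilde\ell^t_h(x_h,a_h)=\mathbb 1\{x^t_h=x_h,a^t_h=a_h\}(1-r^t_h)/(\mu^t_{1:h}(x_h,a_h)+\gamma_h/p^\star_{1:h}(x_h))$, $\tilde L^t=\sum_{k\le t}\tilde\ell^k$, and $\mu^t\in\arg\min_{\mu\in\Pi_{\max}}\langle\mu_{1:},\tilde L^{t-1}\rangle+\sum_{h=1}^H\frac1{\eta_h}\sum_{(x_h,a_h)}w_h\log w_h$ where $w_h(x_h,a_h)=p^\star_{1:h}(x_h)\mu_{1:h}(x_h,a_h)$. *)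

(* Defs.v *)
From HB Require Import structures.
From mathcomp Require Import all_boot all_order all_algebra.
From mathcomp Require Import all_classical all_reals all_analysis.
Set Implicit Arguments.
Unset Strict Implicit.
Unset Printing Implicit Defensive.
Import Order.TTheory GRing.Theory Num.Theory.
Local Open Scope ring_scope.

(** * Tree of information sets of the max-player (perfect recall).
    [X] : information sets, [Ac] : a finite universe of action labels,
    [acts x] : the action set A(x) (as a subset of [Ac]),
    [lvl x] : the step of [x], 0-based ([lvl x = h-1] for [x \in X_h]),
    [par x] : [Some (x_{h-1}, a_{h-1})], the last pair of the (unique)
              history of [x], or [None] when [x \in X_1]. *)
Section Tree.
Context (X Ac : finType) (H : nat) (lvl : X -> nat) (acts : X -> {set Ac})
        (par : X -> option (X * Ac)).

Definition efg_wf : Prop :=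
  [/\ forall x, (lvl x < H)%N,
      forall x, (0 < #|acts x|)%N,
      forall x, par x = None <-> lvl x = 0%N,
      forall x y a, par x = Some (y, a) -> lvl x = (lvl y).+1 /\ a \in acts y &
      forall y a, a \in acts y -> ((lvl y).+1 < H)%N ->
        exists x, par x = Some (y, a)].

(** history (x_{h-1},a_{h-1}), ..., (x_1,a_1) of x (fuel H suffices) *)
Fixpoint histn (n : nat) (x : X) : seq (X * Ac) :=
  match n with
  | 0%N => [::]
  | n'.+1 => match par x with
             | None => [::]
             | Some (y, a) => (y, a) :: histn n' y
             end
  end.
Definition hist (x : X) : seq (X * Ac) := histn H x.

Definition desc (x' x : X) : bool := (x' == x) || (x \in map fst (hist x')).

Definition children (y : X) (a : Ac) : {set X} := [set x | par x == Some (y, a)].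

Section Reals.
Context (R : realType).

Definition is_policy (mu : X -> Ac -> R) : Prop :=
  forall x, (forall a, a \in acts x -> 0 <= mu x a) /\
            \sum_(a in acts x) mu x a = 1.

Definition real_plan (mu : X -> Ac -> R) (x : X) (a : Ac) : R :=
  mu x a * \prod_(ya <- hist x) mu ya.1 ya.2.

Fixpoint reachn (p0 : X -> R) (pt : X -> Ac -> X -> R) (n : nat) (x : X) : R :=
  match n with
  | 0%N => p0 x
  | n'.+1 => match par x with
             | None => p0 x
             | Some (y, a) => reachn p0 pt n' y * pt y a x
             end
  end.
Definition reach p0 pt (x : X) : R := reachn p0 pt H x.

(** the quantities (p^nu_0, p^nu_h, r^nu_h) induced by a min-player policy:
    p0 is a distribution on X_1, pt y a a distribution on X_{h+1}(y,a),
    rewards in [0,1] *)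
Definition env_wf (p0 : X -> R) (pt : X -> Ac -> X -> R) (rw : X -> Ac -> R) : Prop :=
  [/\ forall x, 0 <= p0 x,
      \sum_(x | lvl x == 0%N) p0 x = 1,
      forall y a x, 0 <= pt y a x,
      forall y a, a \in acts y -> ((lvl y).+1 < H)%N ->
        \sum_(x in children y a) pt y a x = 1 &
      forall x a, 0 <= rw x a <= 1].

Definition loss p0 pt (rw : X -> Ac -> R) (x : X) (a : Ac) : R :=
  reach p0 pt x * (1 - rw x a).

Definition inner (mu : X -> Ac -> R) (l : X -> Ac -> R) : R :=
  \sum_x \sum_(a in acts x) real_plan mu x a * l x a.

Definition AX : R := \sum_x (#|acts x|)%:R.
Definition Atau (x : X) : R := \sum_(x' | desc x' x) (#|acts x'|)%:R.
Definition pstar0 (x : X) : R := Atau x / AX.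
Definition pstart (y : X) (a : Ac) (x : X) : R :=
  Atau x / \sum_(x' in children y a) Atau x'.
Definition pstar (x : X) : R := reach pstar0 pstart x.

(** Shannon balanced regularizer; [eta] indexed by the 0-based step *)
Definition reg (eta : nat -> R) (mu : X -> Ac -> R) : R :=
  \sum_x \sum_(a in acts x)
     (eta (lvl x))^-1 * (pstar x * real_plan mu x a * ln (pstar x * real_plan mu x a)).

(** IX loss estimator summed over episodes 1..t (pathwise), [gamma] indexed
    by the 0-based step; [xo k h], [ao k h], [ro k h] are the observations of
    episode k at (0-based) step h, [mu k] the policy of episode k *)
Definition Ltilde (mu : nat -> X -> Ac -> R) (xo : nat -> nat -> X)
    (ao : nat -> nat -> Ac) (ro : nat -> nat -> R) (gamma : nat -> R)
    (t : nat) (x : X) (a : Ac) : R :=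
  \sum_(1 <= k < t.+1)
    (if (xo k (lvl x) == x) && (ao k (lvl x) == a)
     then (1 - ro k (lvl x)) / (real_plan (mu k) x a + gamma (lvl x) / pstar x)
     else 0).

Definition balanced_ftrl (T : nat) (eta gamma : nat -> R)
    (mu : nat -> X -> Ac -> R) xo ao ro : Prop :=
  forall t, (1 <= t <= T)%N ->
    is_policy (mu t) /\
    forall mu', is_policy mu' ->
      inner (mu t) (Ltilde mu xo ao ro gamma t.-1) + reg eta (mu t)
      <= inner mu' (Ltilde mu xo ao ro gamma t.-1) + reg eta mu'.

Section Prob.
Local Open Scope classical_set_scope.
Context (d : measure_display) (Omega : measurableType d) (P : probability Omega R).

Definition sub_sigma (G : set (set Omega)) : Prop :=
  sigma_algebra setT G /\ G `<=` measurable.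

Definition Gmeas (G : set (set Omega)) (f : Omega -> R) : Prop :=
  forall B : set R, measurable B -> G (f @^-1` B).

Definition Gmeas_fin (T : eqType) (G : set (set Omega)) (f : Omega -> T) : Prop :=
  forall v, G [set w | f w = v].

Definition cond_exp_is (G : set (set Omega)) (f g : Omega -> R) : Prop :=
  forall B, G B ->
    (\int[P]_(w in B) (f w)%:E = \int[P]_(w in B) (g w)%:E)%E.

(** The interaction protocol over T episodes. [F t] is the filtration
    (containing the observations of episodes <= t and nu^{t+1});
    [p0 t w], [pt t w], [rw t w] are the quantities induced by the
    (adaptive) opponent policy nu^t. *)
Definition protocol (T : nat) (F : nat -> set (set Omega))
    (mu : nat -> Omega -> X -> Ac -> R)
    (p0 : nat -> Omega -> X -> R) (pt : nat -> Omega -> X -> Ac -> X -> R)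
    (rw : nat -> Omega -> X -> Ac -> R)
    (xo : nat -> nat -> Omega -> X) (ao : nat -> nat -> Omega -> Ac)
    (ro : nat -> nat -> Omega -> R) : Prop :=
  [/\ (forall t, sub_sigma (F t)),
      (forall t, F t `<=` F t.+1),
      (forall t, (1 <= t <= T)%N ->
         (forall x a, Gmeas (F t.-1) (fun w => mu t w x a)) /\
         (forall x, Gmeas (F t.-1) (fun w => p0 t w x)) /\
         (forall y a x, Gmeas (F t.-1) (fun w => pt t w y a x)) /\
         (forall x a, Gmeas (F t.-1) (fun w => rw t w x a)) /\
         (forall w, env_wf (p0 t w) (pt t w) (rw t w))),
      (forall t h, (1 <= t <= T)%N -> (h < H)%N ->
         [/\ Gmeas_fin (F t) (xo t h), Gmeas_fin (F t) (ao t h),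
             Gmeas (F t) (ro t h) & forall w, 0 <= ro t h w <= 1]) &
      (forall t h x a, (1 <= t <= T)%N -> lvl x = h -> a \in acts x ->
         cond_exp_is (F t.-1)
           (fun w => if (xo t h w == x) && (ao t h w == a) then 1 else 0)
           (fun w => reach (p0 t w) (pt t w) x * real_plan (mu t w) x a) /\
         cond_exp_is (F t.-1)
           (fun w => if (xo t h w == x) && (ao t h w == a) then 1 - ro t h w else 0)
           (fun w => real_plan (mu t w) x a * loss (p0 t w) (pt t w) (rw t w) x a))].

End Prob.
End Reals.
End Tree.

(* Main.v *)
(** The regret splits as <mu - mud, l> = <mu, l - lt> + <mud, lt - l>
    + <mu - mud, lt>, where lt is the implicit exploration (IX) estimate of the
    loss l, mu the played policy and mud the comparator.

    The last term is the regret of FTRL on the estimated losses: the entropy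
    costs ln AX / eta_h at each step h, and the stability costs
    eta_h / 2 * sum (lt / pstar), because a plan times its loss estimate is at
    most 1.  For each pair (x, a) the process
    exp (b * (sum lt - sum l)), with b = gamma_h / pstar x, is a
    supermartingale, which controls lt by l + iota / b; a second-order
    exponential supermartingale controls the conditional mean of <mu, lt> minus
    its value; the bias of lt is at most b * l.  Balancing enters through
    sum_(x at step h, a) p^nu(x) / pstar(x) <= AX / A^(H-h), so that the
    contributions of the steps form a geometric series of ratio 1 / sqrt A.
    If T < AX the bound is trivial, since the regret is at most H * T and
    H <= 2 ln AX. *)
Require Import Defs.
From HB Require Import structures.
From mathcomp Require Import all_boot all_order all_algebra.
From mathcomp Require Import all_classical all_reals all_analysis.
From mathcomp Require Import measurable_realfun ring lra zify.
Import Order.TTheory GRing.Theory Num.Theory.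
Local Open Scope ring_scope.
Local Open Scope classical_set_scope.
Set Implicit Arguments.
Unset Strict Implicit.

(** * Trees of information sets and balanced transitions *)

Section TreeTheory.
Context (X Ac : finType) (H : nat) (lvl : X -> nat) (acts : X -> {set Ac}).
Context (par : X -> option (X * Ac)) (R : realType).
Context (wf : efg_wf H lvl acts par).
Implicit Types (x y z : X) (a b : Ac) (mu : X -> Ac -> R).

Local Notation plan := (@real_plan X Ac H par R).
Local Notation reach := (@reach X Ac H par R).
Local Notation Atau := (@Atau X Ac H acts par R).
Local Notation AX := (@AX X Ac acts R).
Local Notation pstar := (@pstar X Ac H acts par R).
Local Notation pstar0 := (@pstar0 X Ac H acts par R).
Local Notation pstart := (@pstart X Ac H acts par R).
Local Notation children := (@children X Ac par).

(** The event must serve all comparators at once. Each pair (x, a) therefore gets its own upper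
    bound on the summed estimates, with slack iota * pstar x / gamma_h; since pstar * plan sums to 1
    on every level for every policy, the slack costs iota / gamma_h per level whatever the
    comparator. These pairwise bounds control lt from above, whereas <mu, l - lt> needs lt bounded
    from below. Hence a separate process, centred at the conditional mean of <mu, lt>, and a
    deterministic bias between that mean and <mu, l>. Inserting the pairwise bounds in the stability
    term leaves an excess AX * sqrt (ln AX * iota). It is at most sqrt (AX * T) * iota once AX <= T,
    which is why the runs with T < AX are treated apart. *)

Lemma lvl_lt x : (lvl x < H)%N. Proof. by case: wf. Qed.

Lemma par_root x : par x = None <-> lvl x = 0%N. Proof. by case: wf. Qed.

Lemma par_child x y a :
  par x = Some (y, a) -> lvl x = (lvl y).+1 /\ a \in acts y.
Proof. by case: wf => _ _ _ + _; apply. Qed.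

Lemma children_lvl x y a : x \in children y a -> lvl x = (lvl y).+1.
Proof. by rewrite inE => /eqP/par_child[]. Qed.

Lemma tree_ind (Q : X -> Prop) :
  (forall x, par x = None -> Q x) ->
  (forall x y a, par x = Some (y, a) -> Q y -> Q x) -> forall x, Q x.
Proof.
move=> Q0 QS x; have [n] := ubnP (lvl x).
elim: n x => // n IH x xn; case px: (par x) => [[y a]|]; last exact: Q0.
apply: (QS x y a px); apply: IH.
by have [lx _] := par_child px; rewrite lx ltnS in xn.
Qed.

(** The recursion stops at a root, reached after [lvl x] steps. Levels are below H, so fuel H always
    suffices and unfolding one step may change the fuel. *)
Lemma histn_stable n m x : (lvl x <= n)%N -> (lvl x <= m)%N ->
  histn par n x = histn par m x.
Proof.
elim: n m x => [|n IH] [|m] x //=.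
- by rewrite leqn0 => /eqP/par_root ->.
- by move=> _; rewrite leqn0 => /eqP/par_root ->.
case px: (par x) => [[y a]|] //.
by have [-> _] := par_child px => ? ?; rewrite (IH m).
Qed.

Lemma hist_root x : par x = None -> hist H par x = [::].
Proof. by rewrite /hist; case: H => //= n ->. Qed.

Lemma hist_child x y a : par x = Some (y, a) ->
  hist H par x = (y, a) :: hist H par y.
Proof.
move=> px; have lx := lvl_lt x; have [ly _] := par_child px.
rewrite /hist; case: H lx => // n; rewrite ltnS ly => yn /=.
by rewrite px (@histn_stable n n.+1) // ltnW // ltnW.
Qed.

Lemma reachn_stable p0 pt n m x : (lvl x <= n)%N -> (lvl x <= m)%N ->
  @reachn X Ac par R p0 pt n x = reachn par p0 pt m x.
Proof.
elim: n m x => [|n IH] [|m] x //=.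
- by rewrite leqn0 => /eqP/par_root ->.
- by move=> _; rewrite leqn0 => /eqP/par_root ->.
case px: (par x) => [[y a]|] //.
by have [-> _] := par_child px => ? ?; rewrite (IH m).
Qed.

Lemma reach_root p0 pt x : par x = None -> reach p0 pt x = p0 x.
Proof. by rewrite /Defs.reach; case: H => //= n ->. Qed.

Lemma reach_child p0 pt x y a : par x = Some (y, a) ->
  reach p0 pt x = reach p0 pt y * pt y a x.
Proof.
move=> px; have lx := lvl_lt x; have [ly _] := par_child px.
rewrite /Defs.reach; case: H lx => // n; rewrite ltnS ly => yn /=.
by rewrite px (@reachn_stable _ _ n n.+1) // ltnW // ltnW.
Qed.

(** The player's own contribution to reaching [x]. With it, realization plans obey the flow
    constraints of the sequence form. *)
Definition parent_plan mu x : R :=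
  if par x is Some (y, a) then plan mu y a else 1.

Lemma planE mu x a : plan mu x a = mu x a * parent_plan mu x.
Proof.
rewrite /real_plan /parent_plan; case px: (par x) => [[y b]|].
  by rewrite (hist_child px) big_cons.
by rewrite hist_root // big_nil.
Qed.

Lemma sum_plan mu x : is_policy acts mu ->
  \sum_(a in acts x) plan mu x a = parent_plan mu x.
Proof.
move=> /(_ x)[_ mu1]; under eq_bigr do rewrite planE.
by rewrite -big_distrl /= mu1 mul1r.
Qed.

Lemma policy_le1 mu x a : is_policy acts mu -> a \in acts x -> mu x a <= 1.
Proof.
move=> /(_ x)[mu0 <-] ax; rewrite (bigD1 a) //= lerDl sumr_ge0 //.
by move=> b /andP[/mu0].
Qed.

Lemma parent_plan_itv mu x : is_policy acts mu -> 0 <= parent_plan mu x <= 1.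
Proof.
move=> mup; elim/tree_ind: x => [x|x y a] px; rewrite /parent_plan px.
  by rewrite ler01 lexx.
have [_ ay] := par_child px; rewrite -/(parent_plan _ _) planE.
have := mup y => -[/(_ a ay) m0 _]; have m1 := policy_le1 mup ay.
by move=> /andP[q0 q1]; rewrite mulr_ge0 // mulr_ile1.
Qed.

Lemma plan_itv mu x a : is_policy acts mu -> a \in acts x ->
  0 <= plan mu x a <= 1.
Proof.
move=> mup ax; have := mup x => -[/(_ a ax) m0 _]; have m1 := policy_le1 mup ax.
rewrite planE; have /andP[q0 q1] := parent_plan_itv x mup.
by rewrite mulr_ge0 // mulr_ile1.
Qed.

(** A node below the roots has exactly one parent pair, so the sets [children y a] partition the
    next level. *)
Lemma sum_child h (f : X -> R) :
  \sum_(x | lvl x == h.+1) f x =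
  \sum_(y | lvl y == h) \sum_(a in acts y) \sum_(x in children y a) f x.
Proof.
rewrite (pair_big_dep (fun y => lvl y == h) (fun y a => a \in acts y)) /=.
rewrite (exchange_big_dep (fun x => lvl x == h.+1)) /=; last first.
  by move=> [y a] x /andP[/eqP <- _] /children_lvl ->.
apply: eq_bigr => x /eqP lx; case px: (par x) => [[y a]|]; last first.
  by move/par_root: px; rewrite lx.
have [ly ay] := par_child px.
rewrite (big_pred1 (y, a)) // => -[z b] /=.
rewrite inE px; apply/andP/eqP => [[_ /eqP[-> ->//]]|[-> ->]].
by move: ly; rewrite lx => -[->]; rewrite eqxx ay.
Qed.

Lemma sum_lvl (f : X -> R) :
  \sum_x f x = \sum_(h < H) \sum_(x | lvl x == h) f x.
Proof. by rewrite (partition_big (fun x => Ordinal (lvl_lt x)) predT). Qed.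

(** Generic in the transitions, to cover both an opponent and the balanced transitions. From one
    level to the next, [pt] sums to 1 over children and [plan] sums to [parent_plan] over
    actions. *)
Lemma flow_lvl p0 pt mu h : is_policy acts mu ->
  \sum_(x | lvl x == 0%N) p0 x = 1 ->
  (forall y a, a \in acts y -> ((lvl y).+1 < H)%N ->
    \sum_(x in children y a) pt y a x = 1) -> (h < H)%N ->
  \sum_(x | lvl x == h) reach p0 pt x * parent_plan mu x = 1.
Proof.
move=> mup p01 pt1; elim: h => [|h IH] hH.
  rewrite -[RHS]p01; apply: eq_bigr => x /eqP /par_root px.
  by rewrite reach_root // /parent_plan px mulr1.
rewrite sum_child -[RHS]IH; last exact: ltnW.
apply: eq_bigr => y /eqP ly; rewrite -sum_plan // mulr_sumr.
apply: eq_bigr => a ay.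
rewrite -[RHS]mulr1 -(pt1 y a ay); last by rewrite ly.
rewrite mulr_sumr; apply: eq_bigr => x; rewrite inE => /eqP px.
by rewrite (reach_child _ _ px) /parent_plan px; ring.
Qed.

Lemma flow_plan p0 pt mu h : is_policy acts mu ->
  \sum_(x | lvl x == 0%N) p0 x = 1 ->
  (forall y a, a \in acts y -> ((lvl y).+1 < H)%N ->
    \sum_(x in children y a) pt y a x = 1) -> (h < H)%N ->
  \sum_(x | lvl x == h) \sum_(a in acts x) reach p0 pt x * plan mu x a = 1.
Proof.
move=> mup p01 pt1 hH; rewrite -(flow_lvl mup p01 pt1 hH).
by apply: eq_bigr => x _; rewrite -mulr_sumr sum_plan.
Qed.

Lemma reach_itv p0 pt rw x : env_wf H lvl acts par p0 pt rw ->
  0 <= reach p0 pt x <= 1.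
Proof.
move=> [p0p p01 ptp pt1 _]; elim/tree_ind: x => [x px|x y a px /andP[r0 r1]].
  rewrite reach_root // p0p -p01 (bigD1 x) /=; last exact/eqP/par_root.
  by rewrite lerDl sumr_ge0.
rewrite (reach_child _ _ px) mulr_ge0 //= mulr_ile1 //.
have [lx ay] := par_child px.
rewrite -(pt1 y a ay); last by rewrite -lx lvl_lt.
rewrite (bigD1 x) /=; last by rewrite inE px.
by rewrite lerDl sumr_ge0.
Qed.

(** * Descendants, subtree weights and the balanced transitions *)

Lemma desc_root x x' : par x' = None -> desc H par x' x = (x' == x).
Proof. by move=> px; rewrite /desc hist_root //= orbF. Qed.

Lemma desc_child x x' z b : par x' = Some (z, b) ->
  desc H par x' x = (x' == x) || desc H par z x.
Proof.
by move=> px; rewrite /desc (hist_child px) /= in_cons [x == z]eq_sym.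
Qed.

Lemma desc_lvl x x' : desc H par x' x -> (lvl x <= lvl x')%N.
Proof.
elim/tree_ind: x' => [x' px|x' z b px IH].
  by rewrite desc_root // => /eqP ->.
rewrite (desc_child _ px) => /orP[/eqP -> //|/IH].
by have [-> _] := par_child px; exact: leqW.
Qed.

Lemma desc_child_nat x x' z b : par x' = Some (z, b) ->
  (desc H par x' x)%:R = (x' == x)%:R + (desc H par z x)%:R :> R.
Proof.
move=> px; rewrite (desc_child _ px); case: eqP => [<-|_]; last by rewrite add0r.
case dz: (desc _ _ z _); rewrite ?addr0 //.
by have := desc_lvl dz; have [-> _] := par_child px; rewrite ltnn.
Qed.

Lemma sum_delta (Q : pred X) z :
  \sum_(x | Q x) (z == x)%:R = (Q z)%:R :> R.
Proof.
rewrite big_mkcond /= (bigD1 z) //= eqxx big1 ?addr0; first by case: (Q z).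
by move=> x; rewrite eq_sym => /negPf ->; case: ifP.
Qed.

(** A proper descendant of [x] descends from exactly one child of [x]. Real-valued indicators turn
    this disjoint union into a sum, so that subtree weights split linearly. *)
Lemma desc_step x x' :
  (desc H par x' x)%:R = (x' == x)%:R +
    \sum_(a in acts x) \sum_(y in children x a) (desc H par x' y)%:R :> R.
Proof.
(* A node is the child of at most one pair, the one stored in [par z]. *)
have step z : (if par z is Some (w, _) then (w == x)%:R else 0) =
    \sum_(a in acts x) \sum_(y in children x a) (z == y)%:R :> R.
  under eq_bigr => a _ do rewrite sum_delta.
  case pz: (par z) => [[w b]|]; last first.
    by rewrite big1 // => a _; rewrite inE pz.
  have [lz bw] := par_child pz.
  case: eqP => [<-|wx]; last first.
    by rewrite big1 // => a _; rewrite inE pz; case: eqP => // -[]/wx.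
  rewrite (bigD1 b) //= inE pz eqxx big1 ?addr0 // => a /andP[_ ab].
  by rewrite inE pz; case: eqP => // -[ba]; rewrite ba eqxx in ab.
elim/tree_ind: x' => [x' px|x' z b px IH].
  rewrite desc_root // big1 ?addr0 // => a _; rewrite big1 // => y.
  by rewrite inE desc_root // => /eqP py; case: eqP py => // <-; rewrite px.
rewrite (desc_child_nat _ px) IH; congr (_ + _).
under [RHS]eq_bigr do under eq_bigr do rewrite (desc_child_nat _ px).
under [RHS]eq_bigr do rewrite big_split /=.
by rewrite big_split /= -step px.
Qed.

Lemma AtauE x : Atau x = \sum_x' (desc H par x' x)%:R * (#|acts x'|)%:R.
Proof.
rewrite /Defs.Atau big_mkcond; apply: eq_bigr => x' _.
by case: (desc _ _ _ _); rewrite ?mul1r ?mul0r.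
Qed.

Lemma Atau_step x : Atau x = (#|acts x|)%:R +
  \sum_(a in acts x) \sum_(y in children x a) Atau y.
Proof.
rewrite AtauE; under eq_bigr do rewrite desc_step mulrDl.
rewrite big_split /=; congr (_ + _).
  rewrite (bigD1 x) //= eqxx mul1r big1 ?addr0 // => y /negPf ->.
  by rewrite mul0r.
under eq_bigr do rewrite mulr_suml.
rewrite exchange_big; apply: eq_bigr => a _ /=.
under eq_bigr do rewrite mulr_suml.
by rewrite exchange_big; apply: eq_bigr => y _ /=; rewrite AtauE.
Qed.

Lemma Atau_gt0 x : 0 < Atau x.
Proof.
rewrite /Defs.Atau (bigD1 x) /=; last by rewrite /desc eqxx.
by rewrite ltr_wpDr ?sumr_ge0 // ltr0n; case: wf.
Qed.

(** After exchanging the sums, each node counts once because it descends from exactly one root. *)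
Lemma sum_Atau_root : \sum_(x | lvl x == 0%N) Atau x = AX.
Proof.
under eq_bigr do rewrite AtauE; rewrite exchange_big /Defs.AX.
apply: eq_bigr => x' _ /=; rewrite -mulr_suml -[RHS]mul1r; congr (_ * _).
elim/tree_ind: x' => [x' px|x' z b px IH].
  under eq_bigr do rewrite desc_root //.
  by rewrite sum_delta; move/par_root: px => ->.
under eq_bigr do rewrite (desc_child_nat _ px).
by rewrite big_split /= sum_delta IH; have [-> _] := par_child px; rewrite add0r.
Qed.

Lemma AX_gt0 x : 0 < AX.
Proof.
elim/tree_ind: x => // x px; rewrite -sum_Atau_root (bigD1 x) /=.
  by rewrite ltr_wpDr ?Atau_gt0 // sumr_ge0 // => ? _; exact/ltW/Atau_gt0.
exact/eqP/par_root.
Qed.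

Definition child_weight y a : R := \sum_(x in children y a) Atau x.

Lemma child_weight_gt0 x y a : x \in children y a -> 0 < child_weight y a.
Proof.
move=> xy; rewrite /child_weight (bigD1 x) //=.
by rewrite ltr_wpDr ?Atau_gt0 // sumr_ge0 // => ? _; exact/ltW/Atau_gt0.
Qed.

(** The argument of type [X] witnesses that the tree is nonempty; on an empty tree the sum would be
    0. *)
Lemma sum_pstar0 : X -> \sum_(x | lvl x == 0%N) pstar0 x = 1.
Proof.
move=> x; rewrite /Defs.pstar0 -mulr_suml sum_Atau_root divff //.
exact/lt0r_neq0/(AX_gt0 x).
Qed.

Lemma sum_pstart y a : a \in acts y -> ((lvl y).+1 < H)%N ->
  \sum_(x in children y a) pstart y a x = 1.
Proof.
move=> ay yH; rewrite /Defs.pstart -mulr_suml divff //.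
case: wf => _ _ _ _ /(_ y a ay yH)[x px].
by apply/lt0r_neq0/(@child_weight_gt0 x); rewrite inE px.
Qed.

Lemma pstar_gt0 x : 0 < pstar x.
Proof.
rewrite /Defs.pstar; elim/tree_ind: x => [x px|x y a px IH].
  by rewrite reach_root // divr_gt0 ?Atau_gt0 // (AX_gt0 x).
rewrite (reach_child _ _ px) mulr_gt0 // divr_gt0 ?Atau_gt0 //.
by apply: (@child_weight_gt0 x); rewrite inE px.
Qed.

Lemma sum_pstar_plan mu h : is_policy acts mu -> (h < H)%N -> X ->
  \sum_(x | lvl x == h) \sum_(a in acts x) pstar x * plan mu x a = 1.
Proof.
move=> mup hH x; apply: flow_plan => //; [exact: sum_pstar0|exact: sum_pstart].
Qed.

(* The total weight of the reached subtrees, rescaled by the balanced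
   transitions, is AX at the root and can only decrease with the depth. *)
Lemma sum_reach_Atau p0 pt rw h : env_wf H lvl acts par p0 pt rw -> (h < H)%N ->
  \sum_(x | lvl x == h) reach p0 pt x / pstar x * Atau x <= AX.
Proof.
move=> ewf; have [_ p01 ptp pt1 _] := ewf.
elim: h => [|h IH] hH.
  rewrite -[leRHS]mulr1 -p01 mulr_sumr ler_sum // => x /eqP/par_root px.
  rewrite /Defs.pstar !reach_root // /Defs.pstar0.
  have := lt0r_neq0 (Atau_gt0 x); have := lt0r_neq0 (AX_gt0 x) => A0 t0.
  by rewrite le_eqVlt; apply/orP; left; apply/eqP; field; rewrite A0 t0.
apply: le_trans (IH (ltnW hH)); rewrite sum_child ler_sum // => y /eqP ly.
have /andP[ry0 _] := reach_itv y ewf.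
rewrite [in leRHS]Atau_step mulrDr.
apply: (@le_trans _ _ (reach p0 pt y / pstar y *
    \sum_(a in acts y) child_weight y a)); last first.
  by rewrite lerDr mulr_ge0 // divr_ge0 // ltW // pstar_gt0.
rewrite mulr_sumr ler_sum // => a ay.
rewrite -[leRHS]mulr1 -(pt1 y a ay) ?ly // mulr_sumr ler_sum // => x xy.
have cw0 := lt0r_neq0 (child_weight_gt0 xy).
move: (xy); rewrite inE => /eqP px.
rewrite /Defs.pstar !(reach_child _ _ px) -/(pstar y) /Defs.pstart.
rewrite -/(child_weight y a).
have := lt0r_neq0 (Atau_gt0 x); have := lt0r_neq0 (pstar_gt0 y) => s0 t0.
by rewrite le_eqVlt; apply/orP; left; apply/eqP; field; rewrite s0 t0 cw0.
Qed.

Section Uniform.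
Context (A : nat) (actsA : forall x, #|acts x| = A).

Lemma branching_gt0 : X -> (0 < A)%N.
Proof. by move=> x; rewrite -(actsA x); case: wf. Qed.

(** Before the last step every action has a child, so the subtree branches at least A ways at each
    remaining step and its last level alone has this many pairs. *)
Lemma Atau_ge x : (A ^ (H - lvl x))%:R <= Atau x.
Proof.
have [n] := ubnP (H - lvl x); elim: n x => // n IH x xn.
rewrite Atau_step actsA; have := lvl_lt x; rewrite leq_eqVlt => /orP[/eqP xH|xH].
  have -> : (H - lvl x = 1)%N by rewrite -[X in (X - _)%N]xH subSn // subnn.
  rewrite expn1 lerDl sumr_ge0 // => a _.
  by rewrite sumr_ge0 // => ? _; exact/ltW/Atau_gt0.
apply: ler_wpDl => //.
rewrite -(subnSK (lvl_lt x)) expnS natrM -{1}(actsA x) -sum1_card natr_sum.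
rewrite mulr_suml ler_sum // => a ax.
case: wf => _ _ _ _ /(_ x a ax xH)[y py].
have [ly _] := par_child py.
rewrite mul1r (bigD1 y) /=; last by rewrite inE py.
apply: ler_wpDr; first by rewrite sumr_ge0 // => ? _; exact/ltW/Atau_gt0.
by rewrite -ly; apply: IH; rewrite ly; move: xn; rewrite -(subnSK (lvl_lt x)).
Qed.

Lemma AX_ge : X -> (A ^ H)%:R <= AX.
Proof.
move=> x; elim/tree_ind: x => // x px.
rewrite -sum_Atau_root (bigD1 x) /=; last exact/eqP/par_root.
apply: ler_wpDr; first by rewrite sumr_ge0 // => ? _; exact/ltW/Atau_gt0.
by have := Atau_ge x; move/par_root: px => ->; rewrite subn0.
Qed.

(** A node of level h carries A pairs, and A * A^(H-h-1) = A^(H-h) is at most its subtree weight,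
    which reduces the sum to [sum_reach_Atau]. *)
Lemma sum_reach_pstar p0 pt rw h :
  env_wf H lvl acts par p0 pt rw -> (h < H)%N ->
  \sum_(x | lvl x == h) \sum_(a in acts x) reach p0 pt x / pstar x
    <= AX / (A ^ (H - h.+1))%:R.
Proof.
move=> ewf hH; case: (pickP (fun x : X => lvl x == h)) => [x0 _|nox]; last first.
  rewrite big_pred0 // divr_ge0 //; exact: sumr_ge0.
have A0 := branching_gt0 x0.
rewrite ler_pdivlMr ?ltr0n ?expn_gt0 ?A0 // mulr_suml.
apply: le_trans (sum_reach_Atau ewf hH); apply: ler_sum => x /eqP lx.
rewrite sumr_const actsA -[X in X * _]mulr_natr -[leLHS]mulrA -natrM -expnS subnSK //.
have /andP[ry0 _] := reach_itv x ewf.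
rewrite ler_wpM2l // ?divr_ge0 // ?(ltW (pstar_gt0 x)) //.
by rewrite -lx Atau_ge.
Qed.

End Uniform.

(** Policies do not mix linearly but realization plans do: [m] is the conditional distribution, at
    each node, of the mixed plan. *)
Lemma mix_policy mu mu' (s : R) :
  is_policy acts mu -> is_policy acts mu' -> 0 <= s <= 1 ->
  exists2 m, is_policy acts m & forall x a, a \in acts x ->
    plan m x a = (1 - s) * plan mu x a + s * plan mu' x a.
Proof.
move=> mup mup' /andP[s0 s1].
pose q x a := (1 - s) * plan mu x a + s * plan mu' x a.
pose pq x := (1 - s) * parent_plan mu x + s * parent_plan mu' x.
have q_ge0 x a : a \in acts x -> 0 <= q x a.
  move=> ax; have /andP[? _] := plan_itv mup ax.
  have /andP[? _] := plan_itv mup' ax.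
  by rewrite addr_ge0 // mulr_ge0 // subr_ge0.
have sum_q x : \sum_(a in acts x) q x a = pq x.
  by rewrite big_split /= -!mulr_sumr !sum_plan.
(* Where the mixed plan does not reach [x], any local distribution realizes it. *)
pose m x a := if pq x == 0 then mu x a else q x a / pq x.
exists m.
  move=> x; rewrite /m; case: eqP => [_|/eqP pq0]; first exact: mup.
  split=> [a ax|]; last by rewrite -mulr_suml sum_q divff.
  by rewrite divr_ge0 ?q_ge0 // -sum_q sumr_ge0 // => b /q_ge0.
suff step x : parent_plan m x = pq x -> forall a, a \in acts x -> plan m x a = q x a.
  move=> x; apply: (step); elim/tree_ind: x => [x px|x y b px IH].
    by rewrite /pq /parent_plan px !mulr1 subrK.
  have [_ by_] := par_child px.
  by rewrite /pq /parent_plan px step.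
move=> mx a ax; rewrite planE mx /m; case: eqP => [pq0|/eqP pq0]; last first.
  by rewrite divfK.
have := sum_q x; rewrite pq0 => /eqP; rewrite psumr_eq0; last exact: q_ge0.
by move=> /allP/(_ a (mem_index_enum a)); rewrite ax => /eqP ->; rewrite mulr0.
Qed.

End TreeTheory.

(** * Entropic FTRL on a convex set *)

Section Entropy.
Context (R : realType).
Implicit Types (s v w y : R).

Lemma expR_ge_quadratic y : 0 <= y -> 1 + y + y ^+ 2 / 2 <= expR y.
Proof.
rewrite le_eqVlt => /predU1P[<-|y0].
  by rewrite expR0 expr0n /= mul0r !addr0.
pose g (x : R) := expR x - (1 + x + x ^+ 2 / 2).
have dg (x : R) : is_derive x (1 : R) g (expR x - (1 + x)).
  rewrite /g; apply: is_derive_eq.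
  by rewrite /GRing.scale /=; lra.
have cg : {within `[0, y], continuous g}.
  apply: derivable_within_continuous => x _; exact: ex_derive.
have [c] := MVT y0 (fun x _ => dg x) cg.
rewrite in_itv /= /g expR0 expr0n /= mul0r !addr0 subrr => /andP[c0 _].
have := mulr_ge0 (_ : 0 <= expR c - (1 + c)) (ltW y0).
by rewrite subr_ge0 expR_ge1Dx => /(_ isT); rewrite !subr0 => + E; rewrite -E subr_ge0.
Qed.

(** The product (1 - y + y^2/2) (1 + y + y^2/2) = 1 + y^4/4 is at least 1, so the lower bound on e^y
    becomes an upper bound on its inverse. *)
Lemma expRN_le_quadratic y : 0 <= y -> expR (- y) <= 1 - y + y ^+ 2 / 2.
Proof.
move=> y0; have := expR_ge_quadratic y0; have := expR_gt0 y => e0 e1.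
rewrite expRN -div1r ler_pdivrMr //.
have q0 : 0 <= 1 - y + y ^+ 2 / 2 by have := sqr_ge0 (1 - y); nra.
apply: le_trans (ler_wpM2l q0 e1).
have y4 : 0 <= y ^+ 4 by rewrite exprn_ge0.
have -> : (1 - y + y ^+ 2 / 2) * (1 + y + y ^+ 2 / 2) = 1 + y ^+ 4 / 4 by field.
by rewrite lerDl divr_ge0.
Qed.

(** Nonnegativity of w ln (w / v) - w + v, the Kullback-Leibler divergence of unnormalized masses,
    including w = 0. *)
Lemma entropy_tangent w v : 0 <= w -> 0 < v -> w * ln v <= w * ln w + v - w.
Proof.
rewrite le_eqVlt => /predU1P[<- v0|w0 v0]; first by rewrite !mul0r; lra.
have := @ln_sublinear R (v / w); have := @le_ln1Dx R (v / w - 1).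
have vw0 : 0 < v / w by exact: divr_gt0.
rewrite subrKC ln_div // => /(_ _)/wrap[]; first by lra.
move=> h _; have := ler_wpM2l (ltW w0) h.
rewrite !mulrBr mulr1 mulrCA divff ?lt0r_neq0 // mulr1; lra.
Qed.

(* A quantitative form of the strict convexity of w ln w: the Jensen gap
   between w and w' absorbs a linear term of slope y. *)
Lemma entropy_gap s w w' y : 0 < s < 1 -> 0 <= w -> 0 <= w' -> 0 <= y ->
  forall v, v = (1 - s) * w + s * w' ->
  0 <= s * ((w' - v) * y + v * y ^+ 2 / 2) +
       ((1 - s) * (w * ln w) + s * (w' * ln w') - v * ln v).
Proof.
move=> /andP[s0 s1] w0 w'0 y0 v vE.
have [v0|] := ltrP 0 v; last first.
  have sw : 0 <= s * w' by rewrite mulr_ge0 // ltW.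
  have sw' : 0 <= (1 - s) * w by rewrite mulr_ge0 // subr_ge0 ltW.
  move=> v0.
  have /eqP : s * w' = 0 by rewrite vE in v0; lra.
  rewrite mulf_eq0 (gt_eqF s0) => /eqP w'E.
  have /eqP : (1 - s) * w = 0 by rewrite vE in v0; lra.
  rewrite mulf_eq0 subr_eq0 (gt_eqF s1) => /eqP wE.
  by rewrite vE w'E wE !(mulr0, mul0r, addr0, subr0).
(* The tangent is taken at v for w, but at v e^(-y) for w': this point minimizes the divergence from
   v plus the linear term y w'. *)
have e0 := expR_gt0 (- y).
have h1 := entropy_tangent w0 v0.
have := @entropy_tangent w' (v * expR (- y)) w'0 (mulr_gt0 v0 e0).
rewrite lnM // ?posrE // expRK => h2.
have h3 : v * expR (- y) <= v * (1 - y + y ^+ 2 / 2).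
  by rewrite ler_pM2l // expRN_le_quadratic.
have h1' : 0 <= (1 - s) * (w * ln w + v - w - w * ln v).
  by rewrite mulr_ge0 ?subr_ge0 // ltW.
have h2' : 0 <= s * (w' * ln w' + v * (1 - y + y ^+ 2 / 2) - w' - w' * (ln v - y)).
  by rewrite mulr_ge0 ?(ltW s0) //; lra.
have := addr_ge0 h1' h2'; congr (_ <= _).
by move: (ln v) (ln w) (ln w') => lv lw lw'; rewrite vE; field.
Qed.

End Entropy.

Section FTRL.
Context (R : realType) (I : finType) (D : pred I) (c p : I -> R).
Context (c0 : forall i, D i -> 0 < c i) (p0 : forall i, D i -> 0 < p i).
Implicit Types (q m g L : I -> R).

Definition dot q g : R := \sum_(i | D i) q i * g i.
Definition entropy q : R :=
  \sum_(i | D i) c i * (p i * q i * ln (p i * q i)).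

(* The local dual norm of the gradient g at q, up to the factor 2. *)
Definition stab q g : R := \sum_(i | D i) q i * g i ^+ 2 / (2 * c i * p i).

Context (Q : (I -> R) -> Prop).
Context (Q0 : forall q, Q q -> forall i, D i -> 0 <= q i).
Context (Qcvx : forall q q' (s : R), Q q -> Q q' -> 0 < s < 1 ->
  exists2 m, Q m & forall i, D i -> m i = (1 - s) * q i + s * q' i).

(* Comparing q0 with (1 - s) q0 + s q and letting s tend to 0 avoids
   differentiating the entropy, so q0 may lie on the boundary. *)
Lemma ftrl_step L g q0 : Q q0 -> (forall i, D i -> 0 <= g i) ->
  (forall q, Q q -> dot q0 L + entropy q0 <= dot q L + entropy q) ->
  forall q, Q q -> dot q0 L + entropy q0 + dot q0 g - stab q0 g <=
                   dot q (fun i => L i + g i) + entropy q.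
Proof.
move=> Qq0 g0 q0min q Qq.
have dotD : dot q (fun i => L i + g i) = dot q L + dot q g.
  by rewrite /dot -big_split; apply: eq_bigr => i _; rewrite /= mulrDr.
rewrite dotD -subr_ge0.
set B := (X in 0 <= X).
(* Coefficient of s once optimality of [q0] is tested against the mixture and the result is divided
   by s. *)
pose K := dot q0 g - dot q g + stab q g - stab q0 g.
have key s : 0 < s < 1 -> 0 <= B + s * K.
  move=> s01; have [m Qm mE] := Qcvx Qq0 Qq s01; have /andP[s0 s1] := s01.
  have := q0min m Qm.
  have mixE (f : I -> R) : \sum_(i | D i) m i * f i =
      (1 - s) * (\sum_(i | D i) q0 i * f i) + s * (\sum_(i | D i) q i * f i).
    rewrite !mulr_sumr -big_split; apply: eq_bigr => i Di /=.
    by rewrite mE // mulrDl !mulrA.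
  rewrite {2}/dot (mixE L) -/(dot _ _) -/(dot _ _).
  have stabE q' : stab q' g = \sum_(i | D i) q' i * (g i ^+ 2 / (2 * c i * p i)).
    by apply: eq_bigr => i _; rewrite mulrA.
  have : 0 <= s * (dot q g - dot m g + stab m g) +
      ((1 - s) * entropy q0 + s * entropy q - entropy m).
    rewrite /dot /stab /entropy -!sumrB -big_split !mulr_sumr -big_split -sumrB.
    rewrite -big_split; apply: sumr_ge0 => i Di /=.
    have ci := c0 Di; have pi := p0 Di.
    have y0 : 0 <= g i / (c i * p i).
      by rewrite divr_ge0 ?g0 // ltW // mulr_gt0.
    have := @entropy_gap R s _ _ _ s01 (mulr_ge0 (ltW pi) (Q0 Qq0 Di))
      (mulr_ge0 (ltW pi) (Q0 Qq Di)) y0 (p i * m i).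
    move=> /(_ _)/wrap[|]; first by rewrite mE //; ring.
    move=> /(mulr_ge0 (ltW ci)); congr (_ <= _).
    move: (ln _) (ln _) (ln _) => l1 l2 l3.
    by field; rewrite !lt0r_neq0.
  rewrite !stabE {2}/dot !mixE -!stabE -!/(dot _ _).
  move=> h1 h2; rewrite -(pmulr_rge0 _ s0) /B /K; lra.
rewrite leNgt; apply/negP => B0.
have [K0|K0] := lerP K 0; first by have := key 2^-1; nra.
(* The cap 1/2 keeps s below 1; the other bound gives s K <= - B / 2, contradicting B < 0. *)
have := key (Num.min (2^-1) (- B / (2 * K))).
have h : 0 < - B / (2 * K) by rewrite divr_gt0 ?mulr_gt0 ?oppr_gt0.
rewrite lt_min h gt_min /= invr_gt0 invf_lt1 ?ltr0n // (@ltr_nat R 1 2) /=.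
move=> /(_ isT).
have : Num.min 2^-1 (- B / (2 * K)) * K <= - B / (2 * K) * K.
  by rewrite ler_pM2r // ge_min lexx orbT.
rewrite (_ : - B / (2 * K) * K = - B / 2); last by field; rewrite lt0r_neq0.
lra.
Qed.

(** The minimal regularized cumulative loss grows in each round by at least the played loss minus
    [stab]; this is what [ftrl_step] provides, and it telescopes. *)
Lemma ftrl_regret (T : nat) (g q : nat -> I -> R) :
  (0 < T)%N ->
  (forall t i, (1 <= t <= T)%N -> D i -> 0 <= g t i) ->
  (forall t, (1 <= t <= T)%N -> Q (q t) /\ forall q', Q q' ->
    dot (q t) (fun i => \sum_(1 <= k < t) g k i) + entropy (q t) <=
    dot q' (fun i => \sum_(1 <= k < t) g k i) + entropy q') ->
  forall q', Q q' ->
  \sum_(1 <= t < T.+1) (dot (q t) (g t) - dot q' (g t)) <=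
  entropy q' - entropy (q 1%N) + \sum_(1 <= t < T.+1) stab (q t) (g t).
Proof.
move=> T0 g0 qmin.
have dot_sum q' n : dot q' (fun i => \sum_(1 <= k < n) g k i) =
    \sum_(1 <= k < n) dot q' (g k).
  by rewrite /dot exchange_big /=; apply: eq_bigr => i _; rewrite mulr_sumr.
have main t q' : (1 <= t <= T)%N -> Q q' ->
    entropy (q 1%N) + \sum_(1 <= k < t.+1) (dot (q k) (g k) - stab (q k) (g k))
    <= dot q' (fun i => \sum_(1 <= k < t.+1) g k i) + entropy q'.
  elim: t q' => // t IH q' tT Qq'.
  have [Qt tmin] := qmin _ tT.
  have := ftrl_step Qt (fun i => g0 _ i tT) tmin Qq'.
  rewrite (_ : (fun i => _ + _) = fun i => \sum_(1 <= k < t.+2) g k i); last first.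
    by apply/funext => i; rewrite [RHS]big_nat_recr.
  (* The induction hypothesis is used at the next iterate, not at the comparator; in the first round
     the cumulative loss is empty. *)
  have : entropy (q 1%N) + \sum_(1 <= k < t.+1) (dot (q k) (g k) - stab (q k) (g k))
      <= dot (q t.+1) (fun i => \sum_(1 <= k < t.+1) g k i) + entropy (q t.+1).
    case: t IH tT Qt {tmin} => [|t] IH tT Qt.
      by rewrite dot_sum !big_geq // addr0 add0r.
    by apply: IH => //; case/andP: tT => _ /ltnW.
  rewrite [in X in _ -> _ -> X]big_nat_recr //= => h1 h2.
  apply: le_trans h2; lra.
move=> q' Qq'; have := main T q'; rewrite T0 leqnn => /(_ isT Qq').
rewrite dot_sum !sumrB; lra.
Qed.

End FTRL.

(** * Balanced FTRL on realization plans *)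

Section BalancedFTRL.
Context (X Ac : finType) (H : nat) (lvl : X -> nat) (acts : X -> {set Ac}).
Context (par : X -> option (X * Ac)) (R : realType).
Context (wf : efg_wf H lvl acts par).
Context (T : nat) (eta gamma : nat -> R).
Context (eta_gt0 : forall h, (h < H)%N -> 0 < eta h).
Context (gamma_gt0 : forall h, (h < H)%N -> 0 < gamma h).

Local Notation plan := (@real_plan X Ac H par R).
Local Notation inner := (@inner X Ac H acts par R).
Local Notation reg := (@reg X Ac H lvl acts par R eta).
Local Notation AX := (@AX X Ac acts R).
Local Notation pstar := (@pstar X Ac H acts par R).

Definition ix_bias x : R := gamma (lvl x) / pstar x.

Lemma ix_bias_gt0 x : 0 < ix_bias x.
Proof. exact: divr_gt0 (gamma_gt0 (lvl_lt wf x)) (pstar_gt0 R wf x). Qed.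

Definition ix_estimator (m : X -> Ac -> R) (xo : nat -> X) (ao : nat -> Ac)
    (ro : nat -> R) x a : R :=
  if (xo (lvl x) == x) && (ao (lvl x) == a)
  then (1 - ro (lvl x)) / (plan m x a + ix_bias x) else 0.

Section Est.
Context (m : X -> Ac -> R) (xo : nat -> X) (ao : nat -> Ac) (ro : nat -> R).
Context (mp : is_policy acts m).
Context (ro01 : forall h, (h < H)%N -> 0 <= ro h <= 1).

Lemma ix_estimator_ge0 x a : a \in acts x -> 0 <= ix_estimator m xo ao ro x a.
Proof.
move=> ax; rewrite /ix_estimator; case: ifP => // _.
have /andP[_ r1] := ro01 (lvl_lt wf x); have /andP[q0 _] := plan_itv wf mp ax.
by rewrite divr_ge0 ?subr_ge0 // addr_ge0 // ltW // ix_bias_gt0.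
Qed.

Lemma plan_ix_estimator_le1 x a : a \in acts x -> plan m x a * ix_estimator m xo ao ro x a <= 1.
Proof.
move=> ax; rewrite /ix_estimator; case: ifP => _; last by rewrite mulr0 ler01.
have /andP[r0 _] := ro01 (lvl_lt wf x); have /andP[q0 _] := plan_itv wf mp ax.
have b0 := ix_bias_gt0 x; have qb : 0 < plan m x a + ix_bias x by exact: ltr_wpDl.
rewrite mulrA ler_pdivrMr // mul1r; nra.
Qed.

End Est.

Let D (i : X * Ac) : bool := i.2 \in acts i.1.
Let pl m (i : X * Ac) := plan m i.1 i.2.
Let c (i : X * Ac) : R := (eta (lvl i.1))^-1.
Let p (i : X * Ac) : R := pstar i.1.

Lemma sum_pairs (f : X -> Ac -> R) :
  \sum_x \sum_(a in acts x) f x a = \sum_(i | D i) f i.1 i.2.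
Proof.
by rewrite (pair_big_dep predT (fun x a => a \in acts x)); apply: eq_bigl.
Qed.

(** Each pstar * plan is one nonnegative term of a sum over its level equal to 1, so its logarithm
    is nonpositive. *)
Lemma reg_le0 m : is_policy acts m -> reg m <= 0.
Proof.
move=> mp; rewrite /reg; apply: sumr_le0 => x _; apply: sumr_le0 => a ax.
have s0 := pstar_gt0 R wf x; have /andP[q0 _] := plan_itv wf mp ax.
apply: mulr_ge0_le0; first by rewrite invr_ge0 (ltW (eta_gt0 (lvl_lt wf x))).
apply: mulr_ge0_le0; first by rewrite mulr_ge0 // ltW.
apply: ln_le0.
rewrite -(sum_pstar_plan wf mp (lvl_lt wf x) x) (bigD1 x) //= (bigD1 a) //=.
have nn y b : b \in acts y -> 0 <= pstar y * plan m y b.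
  move=> by_; have /andP[? _] := plan_itv wf mp by_.
  by rewrite mulr_ge0 // ltW // (pstar_gt0 R wf).
rewrite -addrA lerDl addr_ge0 ?sumr_ge0 // => [b /andP[]|y _]; first by move=> /nn.
by rewrite sumr_ge0 // => b /nn.
Qed.

(** Uses the tangent of w ln w at the uniform mass 1 / AX: on each level the masses sum to 1 and
    there are at most AX pairs, so the entropy is at most ln AX. *)
Lemma reg_ge m : X -> is_policy acts m ->
  - (ln AX * \sum_(h < H) (eta h)^-1) <= reg m.
Proof.
move=> x0 mp; have N0 := AX_gt0 R wf x0.
rewrite /Defs.reg (sum_lvl wf) mulr_sumr -sumrN ler_sum // => h _.
under eq_bigr => x /eqP lx do rewrite lx -mulr_sumr.
rewrite -mulr_sumr mulrC -mulrN ler_wpM2l ?invr_ge0 ?(ltW (eta_gt0 _)) //.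
have AX1 : 0 < AX^-1 by rewrite invr_gt0.
apply: (@le_trans _ _ (\sum_(x | lvl x == h) \sum_(a in acts x)
    (pstar x * plan m x a * (1 - ln AX) - AX^-1))).
  have -> : \sum_(x | lvl x == h) \sum_(a in acts x)
      (pstar x * plan m x a * (1 - ln AX) - AX^-1) =
      (1 - ln AX) - (\sum_(x | lvl x == h) (#|acts x|)%:R) / AX.
    under eq_bigr do rewrite sumrB -mulr_suml sumr_const.
    rewrite sumrB -mulr_suml (sum_pstar_plan wf mp) // mul1r.
    rewrite mulr_suml; congr (_ - _); apply: eq_bigr => x _.
    by rewrite mulr_natl.
  have : (\sum_(x | lvl x == h) (#|acts x|)%:R) / AX <= 1.
    rewrite ler_pdivrMr // mul1r /Defs.AX [leRHS](bigID (fun x => lvl x == h)) /=.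
    by rewrite lerDl sumr_ge0.
  lra.
apply: ler_sum => x _; apply: ler_sum => a ax.
have w0 : 0 <= pstar x * plan m x a.
  have /andP[? _] := plan_itv wf mp ax.
  by rewrite mulr_ge0 // ltW // (pstar_gt0 R wf).
have := entropy_tangent w0 AX1; rewrite lnV ?posrE //; lra.
Qed.

Lemma balanced_ftrl_regret (x0 : X) (mu : nat -> X -> Ac -> R) xo ao ro mud :
  (0 < T)%N ->
  (forall t h, (1 <= t <= T)%N -> (h < H)%N -> 0 <= ro t h <= 1) ->
  balanced_ftrl H lvl acts par T eta gamma mu xo ao ro -> is_policy acts mud ->
  \sum_(1 <= t < T.+1)
    (inner (mu t) (ix_estimator (mu t) (xo t) (ao t) (ro t)) -
     inner mud (ix_estimator (mu t) (xo t) (ao t) (ro t))) <=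
  ln AX * (\sum_(h < H) (eta h)^-1) +
  \sum_x \sum_(a in acts x)
    eta (lvl x) / (2 * pstar x) * \sum_(1 <= t < T.+1)
      ix_estimator (mu t) (xo t) (ao t) (ro t) x a.
Proof.
move=> T0 ro01 ftrl mudp; have [mu1p _] := ftrl 1%N T0; pose est t := ix_estimator (mu t) (xo t) (ao t) (ro t).
(* The iterates are viewed as realization plans, in which the loss is linear, and are compared on
   available pairs only. *)
pose Q (q : X * Ac -> R) := exists2 m, is_policy acts m & forall i, D i -> q i = pl m i.
have innerE m l : inner m l = dot D (pl m) (fun i => l i.1 i.2).
  by rewrite /Defs.inner sum_pairs.
have regE m : reg m = entropy D c p (pl m) by rewrite /Defs.reg sum_pairs.
have dotE q m l : (forall i, D i -> q i = pl m i) -> dot D q l = dot D (pl m) l.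
  by move=> qm; apply: eq_bigr => i /qm ->.
have entE q m : (forall i, D i -> q i = pl m i) -> entropy D c p q = entropy D c p (pl m).
  by move=> qm; apply: eq_bigr => i /qm ->.
have c0 i : D i -> 0 < c i by rewrite invr_gt0 (eta_gt0 (lvl_lt wf _)).
have p0 i : D i -> 0 < p i by move=> _; exact: pstar_gt0 R wf i.1.
have Q0 q : Q q -> forall i, D i -> 0 <= q i.
  by move=> [m mp qm] i Di; rewrite qm //; have /andP[] := plan_itv wf mp Di.
have Qcvx q q' s : Q q -> Q q' -> 0 < s < 1 ->
    exists2 m, Q m & forall i, D i -> m i = (1 - s) * q i + s * q' i.
  move=> [m mp qm] [m' mp' qm'] /andP[s0 s1].
  have [|m2 m2p m2E] := @mix_policy _ _ _ _ _ _ R wf m m' s mp mp'.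
    by rewrite !ltW.
  exists (pl m2); first by exists m2.
  by move=> i Di; rewrite qm // qm' // /pl m2E.
have Qpl m : is_policy acts m -> Q (pl m) by exists m.
have mup t : (1 <= t <= T)%N -> is_policy acts (mu t) by case/ftrl.
have est0 t i : (1 <= t <= T)%N -> D i -> 0 <= est t i.1 i.2.
  by move=> tT Di; apply: ix_estimator_ge0 => //; [exact: mup|move=> h; exact: ro01].
have LE t : (1 <= t)%N -> (fun i : X * Ac => Ltilde H lvl acts par mu xo ao ro gamma t.-1 i.1 i.2)
    = (fun i => \sum_(1 <= k < t) est k i.1 i.2).
  by move=> t1; rewrite /Ltilde prednK.
have := ftrl_regret c0 p0 Q0 Qcvx (g := fun t i => est t i.1 i.2) T0 est0
  (q := fun t => pl (mu t)) _ (Qpl _ mudp).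
move=> /(_ _)/wrap[t tT|].
  have [_ tmin] := ftrl t tT; split=> [|q [m mp qm]]; first exact/Qpl/mup.
  rewrite (dotE _ _ _ qm) (entE _ _ qm).
  have := tmin m mp; rewrite !innerE !regE LE //; by case/andP: tT.
rewrite -!regE => h.
under eq_bigr do rewrite !innerE.
apply: (le_trans h); apply: lerD.
  by have := reg_le0 mudp; have := reg_ge x0 mu1p; lra.
rewrite sum_pairs; under [leRHS]eq_bigr do rewrite mulr_sumr.
rewrite [leRHS]exchange_big /= !big_nat; apply: ler_sum => t tT.
apply: ler_sum => i Di.
have e0 := est0 t i tT Di.
have := @plan_ix_estimator_le1 (mu t) (xo t) (ao t) (ro t) (mup t tT)
  (fun h hH => ro01 t h tT hH) i.1 i.2 Di.
rewrite -/(est t _ _) -/(pl (mu t) i) => q1.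
have ei := eta_gt0 (lvl_lt wf i.1); have pi := p0 i Di.
rewrite /c (_ : _ / _ = eta (lvl i.1) / (2 * pstar i.1) *
  (pl (mu t) i * est t i.1 i.2 * est t i.1 i.2)); last first.
  by rewrite /p; field; rewrite !lt0r_neq0.
rewrite ler_wpM2l ?ler_piMl // divr_ge0 ?(ltW ei) // mulr_ge0 //.
exact: ltW.
Qed.

End BalancedFTRL.

(** * Bounded random variables and sub-sigma-algebras *)

Section SubSigmaMeasurability.
Context (d : measure_display) (Omega : measurableType d) (R : realType).
Context (G : set (set Omega)) (sG : sigma_algebra setT G).
Implicit Types f g : Omega -> R.

(** Viewing the sub-sigma-algebra as a measurable type gives access to the closure properties of
    measurable functions. *)
Lemma GmeasP f : Gmeas G f <->
  measurable_fun (setT : set (g_sigma_algebraType G)) (f : g_sigma_algebraType G -> R).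
Proof.
have GE : (@measurable _ (g_sigma_algebraType G)) = G by exact: sigma_algebra_id.
split=> [mf _ B mB|mf B mB].
  by rewrite setTI; rewrite GE; exact: mf.
by have := mf measurableT B mB; rewrite setTI GE.
Qed.

Lemma Gmeas_cst (c : R) : Gmeas G (fun=> c).
Proof. by apply/GmeasP; exact: measurable_cst. Qed.

Lemma GmeasD f g : Gmeas G f -> Gmeas G g -> Gmeas G (fun w => f w + g w).
Proof. by move=> /GmeasP ? /GmeasP ?; apply/GmeasP; exact: measurable_funD. Qed.

Lemma GmeasB f g : Gmeas G f -> Gmeas G g -> Gmeas G (fun w => f w - g w).
Proof. by move=> /GmeasP ? /GmeasP ?; apply/GmeasP; exact: measurable_funB. Qed.

Lemma GmeasM f g : Gmeas G f -> Gmeas G g -> Gmeas G (fun w => f w * g w).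
Proof. by move=> /GmeasP ? /GmeasP ?; apply/GmeasP; exact: measurable_funM. Qed.

Lemma Gmeas_prod (I : eqType) (s : seq I) (h : I -> Omega -> R) :
  (forall i, i \in s -> Gmeas G (h i)) -> Gmeas G (fun w => \prod_(i <- s) h i w).
Proof.
move=> mh; apply/GmeasP/measurable_prod => i si; exact/GmeasP/mh.
Qed.

Lemma Gmeas_expR f : Gmeas G f -> Gmeas G (fun w => expR (f w)).
Proof.
by move=> /GmeasP ?; apply/GmeasP; apply: measurableT_comp => //; exact: measurable_expR.
Qed.

(** Nonnegativity lets the inverse be read as the real power -1, a measurable function. *)
Lemma GmeasV f : (forall w, 0 <= f w) -> Gmeas G f -> Gmeas G (fun w => (f w)^-1).
Proof.
move=> f0 /GmeasP mf; apply/GmeasP.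
under eq_fun do rewrite -powR_inv1 //.
exact: measurableT_comp (measurable_powR (-1)) mf.
Qed.

Lemma Gmeas_if (b : Omega -> bool) f g : G [set w | b w] ->
  Gmeas G f -> Gmeas G g -> Gmeas G (fun w => if b w then f w else g w).
Proof.
move=> Gb /GmeasP mf /GmeasP mg; apply/GmeasP; apply: measurable_fun_ifT => //.
apply: (measurable_fun_bool true); rewrite setTI.
have GE : (@measurable _ (g_sigma_algebraType G)) = G by exact: sigma_algebra_id.
by rewrite GE.
Qed.

Lemma Gmeas_lt f g : Gmeas G f -> Gmeas G g -> G [set w | f w < g w].
Proof.
move=> /GmeasP mf /GmeasP mg.
have GE : (@measurable _ (g_sigma_algebraType G)) = G by exact: sigma_algebra_id.
have := @measurable_fun_ltr _ _ _ _ _ _ mf mg measurableT [set true].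
by rewrite setTI GE; apply.
Qed.

Lemma sub_sigmaI A B : G A -> G B -> G (A `&` B).
Proof.
have GE : (@measurable _ (g_sigma_algebraType G)) = G by exact: sigma_algebra_id.
by rewrite -GE; exact: measurableI.
Qed.

End SubSigmaMeasurability.

Section BoundedMean.
Context (d : measure_display) (Omega : measurableType d) (R : realType).
Context (P : probability Omega R).
Implicit Types (f g c u : Omega -> R) (G : set (set Omega)).

(** Boundedness is kept together with measurability, so that integrability under a probability is
    automatic. *)
Definition bdmeas G f := Gmeas G f /\ exists K : R, forall w, `|f w| <= K.

Definition mean f : R := \int[P]_w f w.

Lemma bdmeasS G G' f : G `<=` G' -> bdmeas G f -> bdmeas G' f.
Proof. by move=> GG' [mf bf]; split=> // B /mf /GG'. Qed.

Lemma measurable_sigma : sigma_algebra setT (@measurable d Omega).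
Proof. exact: sigma_algebra_measurable. Qed.

Section Closure.
Context (G : set (set Omega)) (sG : sigma_algebra setT G).

Lemma bdmeas_cst (k : R) : bdmeas G (fun=> k).
Proof. by split; [exact: Gmeas_cst|exists `|k|]. Qed.

Lemma bdmeasD f g : bdmeas G f -> bdmeas G g -> bdmeas G (fun w => f w + g w).
Proof.
move=> [mf [K fK]] [mg [L gL]]; split; first exact: GmeasD.
by exists (K + L) => w; rewrite (le_trans (ler_normD _ _)) // lerD.
Qed.

Lemma bdmeasB f g : bdmeas G f -> bdmeas G g -> bdmeas G (fun w => f w - g w).
Proof.
move=> [mf [K fK]] [mg [L gL]]; split; first exact: GmeasB.
by exists (K + L) => w; rewrite (le_trans (ler_normB _ _)) // lerD.
Qed.

Lemma bdmeasM f g : bdmeas G f -> bdmeas G g -> bdmeas G (fun w => f w * g w).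
Proof.
move=> [mf [K fK]] [mg [L gL]]; split; first exact: GmeasM.
by exists (K * L) => w; rewrite normrM ler_pM.
Qed.

Lemma bdmeas_sum (I : eqType) (s : seq I) (Q : pred I) (h : I -> Omega -> R) :
  (forall i, i \in s -> Q i -> bdmeas G (h i)) ->
  bdmeas G (fun w => \sum_(i <- s | Q i) h i w).
Proof.
elim: s => [_|i s IH mh].
  by under eq_fun do rewrite big_nil; exact: bdmeas_cst.
under eq_fun do rewrite big_cons.
have ms : bdmeas G (fun w => \sum_(j <- s | Q j) h j w).
  by apply: IH => j js; apply: mh; rewrite inE js orbT.
case Qi: (Q i) => //; apply: bdmeasD => //.
by apply: mh => //; rewrite mem_head.
Qed.

Lemma bdmeas_expR f : bdmeas G f -> bdmeas G (fun w => expR (f w)).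
Proof.
move=> [mf [K fK]]; split; first exact: Gmeas_expR.
exists (expR K) => w; rewrite ger0_norm ?expR_ge0 // ler_expR.
exact: le_trans (ler_norm _) (fK w).
Qed.

Lemma bdmeas_itv (a b : R) f : Gmeas G f -> (forall w, a <= f w <= b) -> bdmeas G f.
Proof.
move=> mf fab; split=> //; exists (`|a| + `|b|) => w.
have /andP[aw wb] := fab w.
rewrite ler_norml; have := ler_norm b; have := ler_norm (- a); rewrite normrN.
by have := normr_ge0 a; have := normr_ge0 b; lra.
Qed.

Lemma bdmeas_indic B : G B -> bdmeas G \1_B.
Proof.
move=> GB; apply: (@bdmeas_itv 0 1); last first.
  by move=> w; rewrite indicE; case: (_ \in _); rewrite /= ?lexx ler01.
rewrite (_ : \1_B = fun w => if w \in B then 1 else 0); last first.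
  by apply/funext => w; rewrite indicE; case: (_ \in _).
apply: Gmeas_if => //; [|exact: Gmeas_cst..].
by rewrite (_ : [set w | w \in B] = B) //; apply/seteqP; split=> w /=; rewrite inE.
Qed.

End Closure.

Lemma bdmeas_integrable f : bdmeas measurable f -> P.-integrable setT (EFin \o f).
Proof.
move=> [mf [K fK]]; apply: measurable_bounded_integrable => //.
- exact: le_lt_trans (probability_le1 P measurableT) (ltry _).
- by move=> _ B mB; rewrite setTI; exact: mf.
- exists K; split; first exact: num_real.
  by move=> x Kx w _ /=; exact: le_trans (fK w) (ltW Kx).
Qed.

Lemma mean_cst (k : R) : mean (fun=> k) = k.
Proof.
rewrite /mean Rintegral_cst // (_ : fine _ = 1) ?mulr1 //.
by have /(congr1 fine) := probability_setT P.
Qed.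

Lemma meanD f g : bdmeas measurable f -> bdmeas measurable g ->
  mean (fun w => f w + g w) = mean f + mean g.
Proof. by move=> /bdmeas_integrable ? /bdmeas_integrable ?; rewrite /mean RintegralD. Qed.

Lemma meanB f g : bdmeas measurable f -> bdmeas measurable g ->
  mean (fun w => f w - g w) = mean f - mean g.
Proof. by move=> /bdmeas_integrable ? /bdmeas_integrable ?; rewrite /mean RintegralB. Qed.

Lemma meanZ (k : R) f : bdmeas measurable f -> mean (fun w => k * f w) = k * mean f.
Proof. by move=> /bdmeas_integrable ?; rewrite /mean RintegralZl. Qed.

Lemma le_mean f g : bdmeas measurable f -> bdmeas measurable g ->
  (forall w, f w <= g w) -> mean f <= mean g.
Proof.
by move=> /bdmeas_integrable ? /bdmeas_integrable ? fg; apply: le_Rintegral.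
Qed.

Lemma mean_sum (I : eqType) (s : seq I) (Q : pred I) (h : I -> Omega -> R) :
  (forall i, i \in s -> Q i -> bdmeas measurable (h i)) ->
  mean (fun w => \sum_(i <- s | Q i) h i w) = \sum_(i <- s | Q i) mean (h i).
Proof.
elim: s => [_|i s IH mh].
  by under [in LHS]eq_fun do rewrite big_nil; rewrite mean_cst big_nil.
have mh' j : j \in s -> Q j -> bdmeas measurable (h j).
  by move=> js; apply: mh; rewrite inE js orbT.
under [in LHS]eq_fun do rewrite big_cons.
rewrite big_cons -IH //; case Qi: (Q i) => //.
rewrite meanD //; first by apply: mh => //; rewrite mem_head.
exact: (bdmeas_sum measurable_sigma).
Qed.

Lemma mean_indic B f :
  mean (fun w => \1_B w * f w) = fine (\int[P]_(w in B) (f w)%:E).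
Proof.
rewrite -[RHS]/(Rintegral P B f) Rintegral_mkcond /mean.
congr (Rintegral P setT _); apply/funext => w; rewrite patchE indicE.
by case: (_ \in _); rewrite /= ?mul1r ?mul0r.
Qed.

(* The sum is x rounded down to the grid of mesh e. *)
Lemma staircase (e x : R) N : 0 < e -> 0 <= x <= N.+1%:R * e ->
  x - e <= \sum_(k < N) e * (k.+1%:R * e <= x)%R%:R <= x.
Proof.
move=> e0 /andP[x0 xN].
have key M : [/\ \sum_(k < M) e * (k.+1%:R * e <= x)%R%:R <= x,
    x <= M.+1%:R * e -> x - e <= \sum_(k < M) e * (k.+1%:R * e <= x)%R%:R &
    M.+1%:R * e <= x -> \sum_(k < M) e * (k.+1%:R * e <= x)%R%:R = M%:R * e].
  elim: M => [|M [IH1 IH2 IH3]].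
    by rewrite big_ord0 mul0r mul1r; split=> //; lra.
  have n1 : M.+1%:R = M%:R + 1 :> R by rewrite natr1.
  have n2 : M.+2%:R = M%:R + 1 + 1 :> R by rewrite !natr1.
  rewrite big_ord_recr /=; move: (\sum_(k < M) _) IH1 IH2 IH3 => S.
  case: (lerP (M.+1%:R * e) x) => Mx /= IH1 IH2 IH3; last first.
    rewrite mulr0 addr0; split=> //; first by move=> _; apply: IH2; exact: ltW.
    by rewrite n2; rewrite n1 in Mx => h; exfalso; lra.
  rewrite (IH3 isT) mulr1; rewrite n1 in Mx; rewrite n1 n2.
  by split=> [|?|?]; lra.
have [k1 k2 _] := key N; by rewrite k1 k2.
Qed.

(* c is a uniform limit of staircases over its level sets, which lie in G. *)
Lemma cond_exp_mul G f g c : sub_sigma G -> cond_exp_is P G f g ->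
  bdmeas measurable f -> bdmeas measurable g -> bdmeas G c ->
  mean (fun w => c w * f w) = mean (fun w => c w * g w).
Proof.
move=> [sG GM] fg bf bg [mc [K cK]].
pose u w := f w - g w.
have sM := measurable_sigma.
have bM A : G A -> bdmeas measurable \1_A by move=> /GM; exact: (bdmeas_indic sM).
have bu : bdmeas measurable u by exact: (bdmeasB sM).
have bc : bdmeas measurable c by split; [move=> B /mc /GM|exists K].
have u0 A : G A -> mean (fun w => \1_A w * u w) = 0.
  move=> GA; under [in LHS]eq_fun do rewrite mulrBr.
  rewrite meanB; [|exact: (bdmeasM sM (bM _ GA))..].
  by rewrite !mean_indic fg // subrr.
suff cu0 : mean (fun w => c w * u w) = 0.
  apply/eqP; rewrite -subr_eq0 -meanB; [|exact: (bdmeasM sM)..].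
  by rewrite -cu0; apply/eqP; congr mean; apply/funext => w; rewrite mulrBr.
have [U uU] := bu.2.
have K0 : 0 <= K by apply: le_trans (normr_ge0 _) (cK point).
have U0 : 0 <= U by apply: le_trans (normr_ge0 _) (uU point).
have small e : 0 < e -> `|mean (fun w => c w * u w)| <= e * U.
  move=> e0.
  (* [c + K] ranges over [0, 2 K], and this N makes the N + 1 cells of mesh e cover that range. *)
  pose N := Num.truncn (2 * K / e).
  pose cN w : R := - K + \sum_(k < N) e * \1_[set w | k.+1%:R * e <= c w + K] w.
  have GN (k : 'I_N) : G [set w | k.+1%:R * e <= c w + K].
    rewrite (_ : [set _ | _] = c @^-1` `[k.+1%:R * e - K, +oo[); first exact: mc.
    by apply/seteqP; split=> w /=; rewrite in_itv /= andbT lerBlDr.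
  have bN : bdmeas measurable cN.
    apply: bdmeasD => //; first exact: (bdmeas_cst sM).
    apply: bdmeas_sum => // k _ _; apply: bdmeasM => //; first exact: (bdmeas_cst sM).
    exact/bM/GN.
  have cN0 : mean (fun w => cN w * u w) = 0.
    under [in LHS]eq_fun do rewrite mulrDl mulr_suml.
    have bk (k : 'I_N) : bdmeas measurable
        (fun w => e * \1_[set w | k.+1%:R * e <= c w + K] w * u w).
      apply: bdmeasM => //; apply: bdmeasM => //; first exact: (bdmeas_cst sM).
      exact/bM/GN.
    rewrite meanD; [|by apply: bdmeasM => //; exact: (bdmeas_cst sM)|by apply: bdmeas_sum].
    rewrite mean_sum // meanZ // big1 => [|k _].
      (* The whole space is a set of G, so u has mean 0 and the constant - K contributes nothing. *)
      have := u0 setT; rewrite addr0 => h.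
      have -> : mean u = 0.
        rewrite -h; last by have [G0 GC _] := sG; rewrite -(setD0 setT); exact: GC.
        by congr mean; apply/funext => w; rewrite indicE in_setT mul1r.
      by rewrite mulr0.
    under [in LHS]eq_fun do rewrite -mulrA.
    rewrite meanZ ?u0 ?mulr0 //; exact: (bdmeasM sM (bM _ (GN k))).
  have close w : `|(c w - cN w) * u w| <= e * U.
    rewrite normrM ler_pM //; rewrite ler_norml.
    have : 0 <= c w + K <= N.+1%:R * e.
      have := cK w; rewrite ler_norml => /andP[c1 c2].
      rewrite -lerBlDr sub0r c1 /=.
      have /andP[_] := truncn_itv (divr_ge0 (mulr_ge0 (ler0n R 2) K0) (ltW e0)).
      rewrite ltr_pdivrMr // -/N => h; lra.
    move=> /(staircase e0); rewrite /cN.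
    under [X in _ <= X <= _ -> _]eq_bigr => k _.
      rewrite (_ : (_ <= _)%R%:R = \1_[set w | k.+1%:R * e <= c w + K] w :> R); last first.
        by rewrite indicE; congr (nat_of_bool _)%:R; apply/idP/idP; rewrite inE.
      over.
    move=> /andP[]; lra.
  have bcu : bdmeas measurable (fun w => (c w - cN w) * u w).
    by apply: bdmeasM => //; exact: (bdmeasB sM).
  have -> : mean (fun w => c w * u w) = mean (fun w => (c w - cN w) * u w).
    rewrite -[LHS]subr0 -cN0 -meanB; [|exact: (bdmeasM sM)..].
    by congr mean; apply/funext => w; rewrite mulrBl.
  rewrite ler_norml -(mean_cst (e * U)) -(mean_cst (- mean _)).
  rewrite !le_mean ?mean_cst //; try exact: (bdmeas_cst sM).
    by move=> w; have := close w; rewrite ler_norml => /andP[].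
  by move=> w; have := close w; rewrite ler_norml => /andP[].
(* The bound U may be 0, hence the division by U + 1 below. *)
apply/eqP; rewrite -normr_le0; apply/ler_addgt0Pl => e e0; rewrite addr0.
have U1 : 0 < U + 1 by lra.
apply: le_trans (small (e / (U + 1)) (divr_gt0 e0 U1)) _.
by rewrite -mulrA ler_piMr ?(ltW e0) // mulrC ler_pdivrMr // mul1r lerDl.
Qed.

Lemma markov_mean f (kappa : R) : 0 < kappa -> bdmeas measurable f ->
  (forall w, 0 <= f w) ->
  ((1 - mean f / kappa)%:E <= P [set w | (f w < kappa)%R])%E.
Proof.
move=> k0 bf f0; have sM := measurable_sigma.
set B := [set _ | _].
have mB : measurable B by apply: Gmeas_lt => //; [exact: bf.1|exact: Gmeas_cst].
have bB : bdmeas measurable \1_B by exact: (bdmeas_indic sM).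
rewrite -(@fineK _ (P B)) ?fin_num_measure // lee_fin.
have -> : fine (P B) = mean (fun w => \1_B w * 1).
  by rewrite mean_indic integral_cst // mul1e.
rewrite lerBlDr -lerBlDl ler_pdivlMr // -[X in X - _](mean_cst 1) -meanB //; last first.
- by apply: bdmeasM => //; exact: (bdmeas_cst sM).
- exact: (bdmeas_cst sM).
rewrite mulrC -meanZ; last first.
  by apply: bdmeasB => //; [exact: (bdmeas_cst sM)|apply: bdmeasM => //; exact: (bdmeas_cst sM)].
apply: le_mean => //.
  apply: bdmeasM => //; first exact: (bdmeas_cst sM).
  by apply: bdmeasB => //; [exact: (bdmeas_cst sM)|apply: bdmeasM => //; exact: (bdmeas_cst sM)].
move=> w; rewrite mulr1 indicE; case: (boolP (w \in B)) => /=.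
  by rewrite subrr mulr0.
by rewrite notin_setE /B /= subr0 mulr1 leNgt => /negP.
Qed.

End BoundedMean.

(** * Exponential supermartingales *)

Section Supermartingale.
Context (d : measure_display) (Omega : measurableType d) (R : realType).
Context (P : probability Omega R).
Implicit Types (f g W : Omega -> R) (G : set (set Omega)).
Local Notation mean := (mean P).

(** The hypothesis on [W] is the integrated form of E[exp D_t | F_(t-1)] <= 1; it is used with [W]
    the exponential of the sum up to t - 1. *)
Lemma exp_supermartingale (F : nat -> set (set Omega)) (T : nat)
    (D : nat -> Omega -> R) :
  (forall t, sub_sigma (F t)) -> (forall t, F t `<=` F t.+1) ->
  (forall t, (1 <= t <= T)%N -> bdmeas (F t) (D t)) ->
  (forall t W, (1 <= t <= T)%N -> bdmeas (F t.-1) W -> (forall w, 0 <= W w) ->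
    mean (fun w => W w * expR (D t w)) <= mean W) ->
  mean (fun w => expR (\sum_(1 <= t < T.+1) D t w)) <= 1.
Proof.
move=> FS Fmon mD step.
have key n : (n <= T)%N ->
    bdmeas (F n) (fun w => expR (\sum_(1 <= t < n.+1) D t w)) /\
    mean (fun w => expR (\sum_(1 <= t < n.+1) D t w)) <= 1.
  elim: n => [_|n IH nT].
    under eq_fun do rewrite big_geq // expR0; split; last by rewrite mean_cst.
    exact: bdmeas_cst (FS _).1 _.
  have [bn mn] := IH (ltnW nT).
  under eq_fun do rewrite big_nat_recr //= expRD; split.
    apply: (bdmeasM (FS _).1); first exact: bdmeasS (Fmon n) bn.
    by apply: (bdmeas_expR (FS _).1); exact: mD.
  by apply: le_trans mn; apply: (step n.+1) => // w; exact: expR_ge0.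
by have [] := key T (leqnn _).
Qed.

(* One step of implicit exploration: e^{uf} - 1 <= f u e^u for f in [0, 1],
   and with u = b / (m + b) the factor m u e^u = b (1 - u) e^u is at most b. *)
Lemma ix_step G f m l (b : R) W : sub_sigma G ->
  cond_exp_is P G f (fun w => m w * l w) ->
  Gmeas measurable f -> (forall w, 0 <= f w <= 1) ->
  Gmeas G m -> (forall w, 0 <= m w <= 1) ->
  Gmeas G l -> (forall w, 0 <= l w <= 1) -> 0 < b ->
  bdmeas G W -> (forall w, 0 <= W w) ->
  mean (fun w => W w * expR (b * (f w / (m w + b)) - b * l w)) <= mean W.
Proof.
move=> sG fml mf f01 mm m01 ml l01 b0 bW W0.
have [sG1 GM] := sG; have sM := measurable_sigma Omega.
have bf : bdmeas measurable f by exact: bdmeas_itv mf f01.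
have bm : bdmeas G m by exact: bdmeas_itv mm m01.
have bl : bdmeas G l by exact: bdmeas_itv ml l01.
have mb0 w : 0 < m w + b by have /andP[? _] := m01 w; rewrite ltr_wpDl.
pose u w := b * (m w + b)^-1.
have u01 w : 0 <= u w <= 1.
  rewrite /u divr_ge0 ?(ltW (mb0 _)) ?(ltW b0) //= ler_pdivrMr // mul1r lerDr.
  by case/andP: (m01 w).
have mu : Gmeas G u.
  apply: (GmeasM sG1); first exact: Gmeas_cst.
  apply: (GmeasV sG1) => [w|]; first exact: ltW.
  by apply: (GmeasD sG1) => //; exact: Gmeas_cst.
have bu : bdmeas G u by exact: bdmeas_itv mu u01.
have bcst (k : R) : bdmeas G (fun=> k) by exact: bdmeas_cst.
pose V w := W w * expR (- (b * l w)).
have V0 w : 0 <= V w by rewrite mulr_ge0 // expR_ge0.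
have bV : bdmeas G V.
  apply: (bdmeasM sG1) => //; apply: (bdmeas_expR sG1).
  under eq_fun do rewrite -mulN1r.
  by apply: (bdmeasM sG1) => //; exact: (bdmeasM sG1).
pose C w := V w * (u w * expR (u w)).
have bC : bdmeas G C.
  by apply: (bdmeasM sG1) => //; apply: (bdmeasM sG1) => //; exact: bdmeas_expR.
have up c : bdmeas G c -> bdmeas measurable c by exact: bdmeasS.
have bml : bdmeas G (fun w => m w * l w) by exact: bdmeasM.
have bCf : bdmeas measurable (fun w => C w * f w) by apply: (bdmeasM sM) => //; exact: up.
have bCml : bdmeas measurable (fun w => C w * (m w * l w)).
  by apply: up; exact: bdmeasM.
(* The exponential is first bounded by an affine function of [f] with G-measurable coefficients,
   since only the conditional mean of [f] itself is known. *)
apply: (@le_trans _ _ (mean (fun w => V w + C w * f w))).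
  apply: le_mean; [| |move=> w].
  - apply: (bdmeasM sM); first exact: up.
    apply: (bdmeas_expR sM); apply: (bdmeasB sM); last first.
      by apply: up; exact: bdmeasM.
    under eq_fun do rewrite mulrCA.
    by apply: (bdmeasM sM) => //; exact: up.
  - by apply: (bdmeasD sM) => //; exact: up.
  rewrite (_ : W w * _ = V w * expR (f w * u w)); last first.
    by rewrite /V -mulrA -expRD /u; congr (_ * expR _); ring.
  rewrite (_ : V w + _ = V w * (1 + f w * u w * expR (u w))); last first.
    by rewrite /C; ring.
  rewrite ler_wpM2l //.
  have /andP[f0 f1] := f01 w; have /andP[u0 u1] := u01 w.
  have e0 := expR_gt0 (f w * u w).
  have h1 : expR (f w * u w) <= 1 + f w * u w * expR (f w * u w).
    have := expR_ge1Dx (- (f w * u w)); rewrite expRN -div1r ler_pdivlMr //; lra.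
  have h2 : expR (f w * u w) <= expR (u w) by rewrite ler_expR ler_piMl.
  by apply: (le_trans h1); rewrite lerD2l ler_wpM2l // mulr_ge0.
rewrite meanD //; last exact: up.
rewrite (cond_exp_mul sG fml) //; last exact: up.
rewrite -meanD //; last exact: up.
apply: le_mean; [by apply: (bdmeasD sM) => //; exact: up|exact: up|move=> w].
rewrite /C /V -mulrA -[X in X + _]mulr1 -mulrDr -mulrA ler_piMr //.
have /andP[m0 m1] := m01 w; have /andP[l0 l1] := l01 w; have /andP[u0 u1] := u01 w.
have h : u w * expR (u w) * m w <= b.
  have mE : u w * m w = b * (1 - u w) by rewrite /u; field; rewrite lt0r_neq0.
  rewrite mulrAC mE -mulrA ler_piMr ?(ltW b0) //.
  have := expR_ge1Dx (- u w); rewrite expRN -div1r ler_pdivlMr ?expR_gt0 //.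
rewrite expRN mulrC ler_pdivrMr ?expR_gt0 // mul1r mulrA.
apply: le_trans (expR_ge1Dx _); rewrite lerD2l.
exact: ler_wpM2r.
Qed.

(** Write Y for the weighted sum of the [f i]. The bound e^(-z) <= 1 - z + z^2/2 holds for all z >=
    0, so with z = lam Y no smallness of [lam] is required. The sum stays explicit because
    conditional means are known term by term. *)
Lemma linear_step (I : finType) (Q : pred I) G (c f g : I -> Omega -> R)
    (lam K : R) W : sub_sigma G ->
  (forall i, Q i -> cond_exp_is P G (f i) (g i)) ->
  (forall i, Q i -> bdmeas G (c i)) ->
  (forall i, Q i -> bdmeas measurable (f i)) ->
  (forall i, Q i -> bdmeas G (g i)) -> 0 <= lam ->
  (forall w, 0 <= \sum_(i | Q i) c i w * f i w <= K) ->
  bdmeas G W -> (forall w, 0 <= W w) ->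
  mean (fun w => W w * expR (lam * (\sum_(i | Q i) c i w * g i w -
    \sum_(i | Q i) c i w * f i w) - (lam * K) ^+ 2 / 2)) <= mean W.
Proof.
move=> sG fg bc bf bg lam0 YK bW W0.
have [sG1 GM] := sG; have sM := measurable_sigma Omega.
have up h : bdmeas G h -> bdmeas measurable h by exact: bdmeasS.
have bcst (k : R) : bdmeas G (fun=> k) by exact: bdmeas_cst.
pose Y w := \sum_(i | Q i) c i w * f i w.
pose M w := \sum_(i | Q i) c i w * g i w.
have bY : bdmeas measurable Y.
  by apply: (bdmeas_sum sM) => i _ Qi; apply: (bdmeasM sM); [exact/up/bc|exact: bf].
have bM : bdmeas G M.
  by apply: (bdmeas_sum sG1) => i _ Qi; apply: (bdmeasM sG1); [exact: bc|exact: bg].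
pose k : R := (lam * K) ^+ 2 / 2.
have k0 : 0 <= k by rewrite divr_ge0 // sqr_ge0.
pose V w := W w * expR (lam * M w - k).
have bV : bdmeas G V.
  apply: (bdmeasM sG1) => //; apply: (bdmeas_expR sG1); apply: (bdmeasB sG1) => //.
  exact: bdmeasM.
have V0 w : 0 <= V w by rewrite mulr_ge0 // expR_ge0.
have bZ (Z : Omega -> R) : bdmeas measurable Z ->
    bdmeas measurable (fun w => V w * (1 + k) - lam * (V w * Z w)).
  move=> bZ; apply: (bdmeasB sM).
    by apply: (bdmeasM sM); exact: up.
  by apply: (bdmeasM sM); [exact: up|apply: (bdmeasM sM) => //; exact: up].
have bVZ (Z : Omega -> R) : bdmeas measurable Z -> bdmeas measurable (fun w => V w * Z w).
  by move=> bZ'; apply: (bdmeasM sM) => //; exact: up.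
have meanE (Z : Omega -> R) : bdmeas measurable Z ->
    mean (fun w => V w * (1 + k) - lam * (V w * Z w)) =
    mean (fun w => V w * (1 + k)) - lam * mean (fun w => V w * Z w).
  move=> bZ'; rewrite meanB; last by apply: (bdmeasM sM); [exact: up|exact: bVZ].
    by rewrite meanZ //; exact: bVZ.
  by apply: (bdmeasM sM); exact: up.
have sumE (a : I -> Omega -> R) : (forall i, Q i -> bdmeas measurable (a i)) ->
    mean (fun w => V w * \sum_(i | Q i) c i w * a i w) =
    \sum_(i | Q i) mean (fun w => V w * c i w * a i w).
  move=> ba; under [in LHS]eq_fun do rewrite mulr_sumr.
  rewrite mean_sum.
    apply: eq_bigr => i _; congr mean.
    by apply/funext => w; rewrite mulrA.
  move=> i _ Qi; apply: (bdmeasM sM); first exact: up.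
  by apply: (bdmeasM sM); [exact/up/bc|exact: ba].
apply: (@le_trans _ _ (mean (fun w => V w * (1 + k) - lam * (V w * Y w)))).
  apply: le_mean; [|exact: bZ|move=> w].
    apply: (bdmeasM sM); first exact: up.
    apply: (bdmeas_expR sM); apply: (bdmeasB sM); last exact: up.
    apply: (bdmeasM sM); first exact: up.
    by apply: (bdmeasB sM) => //; exact: up.
  rewrite -/(Y w) -/(M w) -/k.
  rewrite (_ : lam * (M w - Y w) - k = (lam * M w - k) + - (lam * Y w)); last by ring.
  rewrite expRD mulrA -/(V w) mulrCA -mulrBr ler_wpM2l //.
  have /andP[Y0 YK'] := YK w.
  have := expRN_le_quadratic (mulr_ge0 lam0 Y0).
  have : (lam * Y w) ^+ 2 <= (lam * K) ^+ 2.
    have YK2 : lam * Y w <= lam * K by exact: ler_wpM2l.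
    have lY0 : 0 <= lam * Y w by exact: mulr_ge0.
    by rewrite ler_sqr // nnegrE // (le_trans lY0).
  rewrite -/(Y w) /k; lra.
rewrite meanE // sumE //.
rewrite (eq_bigr (fun i => mean (fun w => V w * c i w * g i w))); last first.
  move=> i Qi; apply: (cond_exp_mul sG (fg i Qi)); [exact: bf|exact/up/bg|].
  by apply: (bdmeasM sG1) => //; exact: bc.
rewrite -sumE; last by move=> i Qi; exact/up/bg.
rewrite -meanE; last exact: up.
apply: le_mean; [exact/bZ/up|exact: up|move=> w].
rewrite -/(M w) mulrCA -mulrBr /V -mulrA ler_piMr //.
have h : 1 + k - lam * M w <= expR (- (lam * M w - k)).
  by apply: le_trans (expR_ge1Dx _); lra.
by apply: le_trans (ler_wpM2l (expR_ge0 _) h) _; rewrite -expRD subrr expR0.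
Qed.

End Supermartingale.

(** * Regret decomposition *)

Section RegretDecomposition.
Context (X Ac : finType) (H : nat) (lvl : X -> nat) (acts : X -> {set Ac}).
Context (par : X -> option (X * Ac)) (R : realType).
Context (wf : efg_wf H lvl acts par) (A : nat) (actsA : forall x, #|acts x| = A).
Context (T : nat) (T_gt0 : (0 < T)%N) (eta gamma : nat -> R).
Context (eta_gt0 : forall h, (h < H)%N -> 0 < eta h).
Context (gamma_gt0 : forall h, (h < H)%N -> 0 < gamma h).

Local Notation plan := (@real_plan X Ac H par R).
Local Notation inner := (@inner X Ac H acts par R).
Local Notation AX := (@AX X Ac acts R).
Local Notation pstar := (@pstar X Ac H acts par R).
Local Notation bias := (@ix_bias X Ac H lvl acts par R gamma).
Local Notation ix_est := (@ix_estimator X Ac H lvl acts par R gamma).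

Lemma sum_lvl_cst (k : nat -> R) (f : X -> Ac -> R) :
  \sum_x \sum_(a in acts x) k (lvl x) * f x a =
  \sum_(h < H) k h * \sum_(x | lvl x == h) \sum_(a in acts x) f x a.
Proof.
rewrite (sum_lvl wf); apply: eq_bigr => h _; rewrite mulr_sumr.
by apply: eq_bigr => x /eqP ->; rewrite mulr_sumr.
Qed.

Lemma sum_reach_lvl (k : nat -> R) p0 pt rw :
  (forall h, (h < H)%N -> 0 <= k h) -> env_wf H lvl acts par p0 pt rw ->
  \sum_x \sum_(a in acts x) k (lvl x) * (reach H par p0 pt x / pstar x) <=
  \sum_(h < H) k h * (AX / (A ^ (H - h.+1))%:R).
Proof.
move=> k0 ewf; rewrite (sum_lvl_cst k (fun x _ => reach H par p0 pt x / pstar x)).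
apply: ler_sum => h _; rewrite ler_wpM2l ?k0 //.
exact: (sum_reach_pstar wf actsA ewf).
Qed.

Lemma sum_episodes_cst (k : R) : \sum_(1 <= t < T.+1) k = T%:R * k.
Proof. by rewrite sumr_const_nat subn1 mulr_natl. Qed.

Lemma inner_sum m (l : nat -> X -> Ac -> R) :
  \sum_(1 <= t < T.+1) inner m (l t) =
  inner m (fun x a => \sum_(1 <= t < T.+1) l t x a).
Proof.
rewrite /Defs.inner exchange_big; apply: eq_bigr => x _ /=.
by rewrite exchange_big; apply: eq_bigr => a _ /=; rewrite mulr_sumr.
Qed.

Context (mu : nat -> X -> Ac -> R).
Context (p0 : nat -> X -> R) (pt : nat -> X -> Ac -> X -> R) (rw : nat -> X -> Ac -> R).
Context (xo : nat -> nat -> X) (ao : nat -> nat -> Ac) (ro : nat -> nat -> R).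
Context (env : forall t, (1 <= t <= T)%N -> env_wf H lvl acts par (p0 t) (pt t) (rw t)).
Context (ro01 : forall t h, (1 <= t <= T)%N -> (h < H)%N -> 0 <= ro t h <= 1).
Context (ftrl : balanced_ftrl H lvl acts par T eta gamma mu xo ao ro).

Local Notation rch t := (Defs.reach H par (p0 t) (pt t)).
Local Notation l := (fun t => loss H par (p0 t) (pt t) (rw t)).
Local Notation est := (fun t => ix_est (mu t) (xo t) (ao t) (ro t)).

(** Conditional mean of [inner (mu t) (est t)] given the past; it falls short of
    [inner (mu t) (l t)] by the IX bias. *)
Definition mean_est t : R := \sum_x \sum_(a in acts x)
  plan (mu t) x a / (plan (mu t) x a + bias x) * (plan (mu t) x a * l t x a).

Lemma policy_mu t : (1 <= t <= T)%N -> is_policy acts (mu t).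
Proof. by case/ftrl. Qed.

Lemma loss_reach t x a : (1 <= t <= T)%N -> 0 <= l t x a <= rch t x.
Proof.
move=> tT; have /andP[r0 _] := reach_itv wf x (env tT).
have [_ _ _ _ /(_ x a)/andP[w0 w1]] := env tT.
by rewrite /loss mulr_ge0 ?subr_ge0 //= ler_piMr // lerBlDr lerDl.
Qed.

(** For each pair, plan - plan^2 / (plan + bias) = bias * plan / (plan + bias) <= bias, and bias *
    reach is gamma_h * reach / pstar. *)
Lemma bias_le t : (1 <= t <= T)%N ->
  inner (mu t) (l t) - mean_est t <=
  \sum_(h < H) gamma h * (AX / (A ^ (H - h.+1))%:R).
Proof.
move=> tT.
apply: le_trans (sum_reach_lvl (fun h hH => ltW (gamma_gt0 hH)) (env tT)).
rewrite /Defs.inner /mean_est -sumrB; apply: ler_sum => x _.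
rewrite -sumrB; apply: ler_sum => a ax.
have /andP[l0 l1] := loss_reach x a tT.
have /andP[q0 q1] := plan_itv wf (policy_mu tT) ax.
have b0 := ix_bias_gt0 wf gamma_gt0 x.
have qb : 0 < plan (mu t) x a + bias x by exact: ltr_wpDl.
rewrite (_ : gamma (lvl x) * _ = bias x * rch t x); last first.
  by rewrite /ix_bias; ring.
apply: le_trans (ler_wpM2l (ltW b0) l1).
rewrite (_ : _ - _ = bias x * l t x a * (plan (mu t) x a / (plan (mu t) x a + bias x))).
  rewrite ler_piMr ?(mulr_ge0 (ltW b0)) // ler_pdivrMr // mul1r lerDl; exact: ltW.
by field; exact: lt0r_neq0.
Qed.

Context (iota M : R).
Context (est_le : forall x a, a \in acts x ->
  \sum_(1 <= t < T.+1) est t x a <= \sum_(1 <= t < T.+1) l t x a + iota / bias x).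
Context (mart_le : \sum_(1 <= t < T.+1) (mean_est t - inner (mu t) (est t)) <= M).

Lemma comparator_le mud : is_policy acts mud -> X ->
  \sum_(1 <= t < T.+1) (inner mud (est t) - inner mud (l t)) <=
  \sum_(h < H) iota / gamma h.
Proof.
move=> mudp x0; rewrite sumrB !inner_sum /Defs.inner -sumrB.
apply: (@le_trans _ _ (\sum_x \sum_(a in acts x)
    iota / gamma (lvl x) * (pstar x * plan mud x a))); last first.
  rewrite (sum_lvl_cst (fun h => iota / gamma h)); apply: ler_sum => h _.
  by rewrite (sum_pstar_plan wf mudp) // mulr1.
apply: ler_sum => x _; rewrite -sumrB; apply: ler_sum => a ax.
have /andP[q0 _] := plan_itv wf mudp ax.
rewrite -mulrBr [leRHS]mulrA [leRHS]mulrC ler_wpM2l //.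
rewrite lerBlDl (le_trans (est_le ax)) // lerD2l /ix_bias invf_div mulrA.
by rewrite mulrAC.
Qed.

(** Estimates are replaced by losses plus their deviation. The last sum is the price of the
    deviations; with the tuned parameters its ratio eta / gamma does not depend on T. *)
Lemma stab_le : X -> \sum_x \sum_(a in acts x)
    eta (lvl x) / (2 * pstar x) * \sum_(1 <= t < T.+1) est t x a <=
  T%:R * (\sum_(h < H) eta h / 2 * (AX / (A ^ (H - h.+1))%:R)) +
  \sum_x \sum_(a in acts x) eta (lvl x) / (2 * gamma (lvl x)) * iota.
Proof.
move=> x0; have ps x := pstar_gt0 R wf x.
apply: (@le_trans _ _ (\sum_x \sum_(a in acts x)
   (\sum_(1 <= t < T.+1) eta (lvl x) / 2 * (rch t x / pstar x) +
    eta (lvl x) / (2 * gamma (lvl x)) * iota))).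
  apply: ler_sum => x _; apply: ler_sum => a ax.
  have e0 := eta_gt0 (lvl_lt wf x); have g0 := gamma_gt0 (lvl_lt wf x).
  have k0 : 0 <= eta (lvl x) / (2 * pstar x).
    by rewrite divr_ge0 ?mulr_ge0 ?(ltW (ps x)) // ltW.
  apply: le_trans (ler_wpM2l k0 (est_le ax)) _; rewrite mulrDr; apply: lerD.
    rewrite mulr_sumr !big_nat; apply: ler_sum => t tT.
    have /andP[_ l1] := loss_reach x a tT.
    apply: le_trans (ler_wpM2l k0 l1) _.
    by rewrite le_eqVlt; apply/orP; left; apply/eqP; field; exact: lt0r_neq0.
  rewrite le_eqVlt; apply/orP; left; apply/eqP; rewrite /ix_bias.
  by field; rewrite !lt0r_neq0.
under eq_bigr do rewrite big_split /=.
rewrite big_split /= lerD2r.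
under eq_bigr do rewrite exchange_big /=.
rewrite exchange_big /= big_nat.
rewrite -sum_episodes_cst [leRHS]big_nat.
apply: ler_sum => t tT; apply: (sum_reach_lvl (k := fun h => eta h / 2)) (env tT).
by move=> h hH; rewrite divr_ge0 // ltW // eta_gt0.
Qed.

(** A pathwise statement: randomness enters only through the bounds [est_le] and [mart_le]. The
    first line holds the bias and the martingale, then come the comparator and the FTRL cost. *)
Lemma regret_decomposition mud : is_policy acts mud -> X ->
  \sum_(1 <= t < T.+1) (inner (mu t) (l t) - inner mud (l t)) <=
  T%:R * (\sum_(h < H) gamma h * (AX / (A ^ (H - h.+1))%:R)) + M +
  \sum_(h < H) iota / gamma h +
  (ln AX * (\sum_(h < H) (eta h)^-1) +
   T%:R * (\sum_(h < H) eta h / 2 * (AX / (A ^ (H - h.+1))%:R)) +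
   \sum_x \sum_(a in acts x) eta (lvl x) / (2 * gamma (lvl x)) * iota).
Proof.
move=> mudp x0.
have h1 : \sum_(1 <= t < T.+1) (inner (mu t) (l t) - mean_est t) <=
    T%:R * (\sum_(h < H) gamma h * (AX / (A ^ (H - h.+1))%:R)).
  rewrite -sum_episodes_cst !big_nat.
  by apply: ler_sum => t; exact: bias_le.
have h2 := comparator_le mudp x0.
have h3 := balanced_ftrl_regret wf eta_gt0 gamma_gt0 x0 T_gt0 ro01 ftrl mudp.
have h4 := stab_le x0.
move: h1 mart_le h2 h3 h4; rewrite !sumrB; lra.
Qed.

End RegretDecomposition.

(** * Concentration of the loss estimates *)

Section Concentration.
Context (X Ac : finType) (H : nat) (lvl : X -> nat) (acts : X -> {set Ac}).
Context (par : X -> option (X * Ac)) (R : realType).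
Context (wf : efg_wf H lvl acts par).
Context (d : measure_display) (Omega : measurableType d) (P : probability Omega R).
Context (T : nat) (F : nat -> set (set Omega)).
Context (mu : nat -> Omega -> X -> Ac -> R).
Context (p0 : nat -> Omega -> X -> R) (pt : nat -> Omega -> X -> Ac -> X -> R).
Context (rw : nat -> Omega -> X -> Ac -> R).
Context (xo : nat -> nat -> Omega -> X) (ao : nat -> nat -> Omega -> Ac).
Context (ro : nat -> nat -> Omega -> R).
Context (pr : protocol H lvl acts par P T F mu p0 pt rw xo ao ro).
Context (mup : forall t w, (1 <= t <= T)%N -> is_policy acts (mu t w)).
Context (gamma : nat -> R) (gamma_gt0 : forall h, (h < H)%N -> 0 < gamma h).

Local Notation plan := (@real_plan X Ac H par R).
Local Notation inner := (@inner X Ac H acts par R).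
Local Notation AX := (@AX X Ac acts R).
Local Notation bias := (@ix_bias X Ac H lvl acts par R gamma).
Local Notation mean := (mean P).
Local Notation l t w := (loss H par (p0 t w) (pt t w) (rw t w)).
Local Notation est t w := (@ix_estimator X Ac H lvl acts par R gamma (mu t w)
  (fun h => xo t h w) (fun h => ao t h w) (fun h => ro t h w)).
Local Notation D := (fun i : X * Ac => i.2 \in acts i.1).

(** Numerator of the IX estimate. The protocol gives its conditional mean, while the denominator is
    already measurable in the past. *)
Definition obs_loss t x a w : R :=
  if (xo t (lvl x) w == x) && (ao t (lvl x) w == a) then 1 - ro t (lvl x) w else 0.

Lemma estE t x a w : est t w x a = obs_loss t x a w / (plan (mu t w) x a + bias x).
Proof. by rewrite /ix_estimator /obs_loss; case: ifP => _; rewrite ?mul0r. Qed.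

Lemma sigF t : sigma_algebra setT (F t).
Proof. by case: pr => /(_ t)[]. Qed.

Lemma F_pred t : (1 <= t)%N -> F t.-1 `<=` F t.
Proof. by case: pr => _ mon _ _ _; case: t => // t _; exact: mon. Qed.

Lemma ro_itv t h w : (1 <= t <= T)%N -> (h < H)%N -> 0 <= ro t h w <= 1.
Proof. by case: pr => _ _ _ + _ => /[apply]/[apply] -[_ _ _]; apply. Qed.

Lemma env_wfP t w : (1 <= t <= T)%N ->
  env_wf H lvl acts par (p0 t w) (pt t w) (rw t w).
Proof. by case: pr => _ _ + _ _ => /[apply] -[_ [_ [_ [_]]]]; apply. Qed.

Lemma obs_loss_itv t x a w : (1 <= t <= T)%N -> 0 <= obs_loss t x a w <= 1.
Proof.
move=> tT; rewrite /obs_loss; case: ifP => _; last by rewrite lexx ler01.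
have /andP[r0 r1] := ro_itv w tT (lvl_lt wf x).
by rewrite subr_ge0 r1 lerBlDr lerDl.
Qed.

Lemma loss_itv t x a w : (1 <= t <= T)%N -> 0 <= l t w x a <= 1.
Proof.
move=> tT; have /andP[r0 r1] := reach_itv wf x (env_wfP w tT).
have [_ _ _ _ /(_ x a)/andP[w0 w1]] := env_wfP w tT.
rewrite /loss mulr_ge0 ?subr_ge0 //= mulr_ile1 ?subr_ge0 //.
by rewrite lerBlDr lerDl.
Qed.

Lemma Gmeas_obs_loss t x a : (1 <= t <= T)%N -> Gmeas (F t) (obs_loss t x a).
Proof.
move=> tT; have [_ _ _ /(_ t (lvl x) tT (lvl_lt wf x))[mx ma mr _] _] := pr.
apply: (Gmeas_if (sigF t)); last exact: (Gmeas_cst (sigF t)).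
  rewrite (_ : [set _ | _] = [set w | xo t (lvl x) w = x] `&`
                            [set w | ao t (lvl x) w = a]).
    exact: (sub_sigmaI (sigF t)).
  apply/seteqP; split => w /=; first by case/andP => /eqP -> /eqP ->.
  by case=> -> ->; rewrite !eqxx.
by apply: (GmeasB (sigF t)) => //; exact: (Gmeas_cst (sigF t)).
Qed.

Lemma Gmeas_plan t x a : (1 <= t <= T)%N ->
  Gmeas (F t.-1) (fun w => plan (mu t w) x a).
Proof.
move=> tT; have [_ _ /(_ t tT)[mm _] _ _] := pr.
rewrite /real_plan; apply: (GmeasM (sigF _)); first exact: mm.
by apply: (Gmeas_prod (sigF _)) => i _; exact: mm.
Qed.

Lemma Gmeas_loss t x a : (1 <= t <= T)%N -> Gmeas (F t.-1) (fun w => l t w x a).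
Proof.
move=> tT; have [_ _ /(_ t tT)[_ [m0 [mt [mr _]]]] _ _] := pr.
rewrite /loss; apply: (GmeasM (sigF _)); last first.
  by apply: (GmeasB (sigF _)); [exact: (Gmeas_cst (sigF _))|exact: mr].
rewrite /reach; elim: (H) x => [|n IH] x /=; first exact: m0.
case: (par x) => [[y b]|]; last exact: m0.
by apply: (GmeasM (sigF _)); [exact: IH|exact: mt].
Qed.

Lemma cond_obs_loss t x a : (1 <= t <= T)%N -> a \in acts x ->
  cond_exp_is P (F t.-1) (obs_loss t x a)
    (fun w => plan (mu t w) x a * l t w x a).
Proof.
move=> tT ax; have [_ _ _ _ /(_ t (lvl x) x a tT erefl ax)[_ ce]] := pr.
exact: ce.
Qed.

Lemma bdmeas_plan t x a : (1 <= t <= T)%N -> a \in acts x ->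
  bdmeas (F t.-1) (fun w => plan (mu t w) x a).
Proof.
move=> tT ax; apply: (bdmeas_itv (a := 0) (b := 1)); first exact: Gmeas_plan.
by move=> w; have /andP[-> ->] := plan_itv wf (mup w tT) ax.
Qed.

Lemma bdmeas_loss t x a : (1 <= t <= T)%N -> bdmeas (F t.-1) (fun w => l t w x a).
Proof.
move=> tT; apply: (bdmeas_itv (a := 0) (b := 1)); first exact: Gmeas_loss.
by move=> w; exact: loss_itv.
Qed.

Lemma bdmeas_obs_loss t x a : (1 <= t <= T)%N -> bdmeas (F t) (obs_loss t x a).
Proof.
move=> tT; apply: (bdmeas_itv (a := 0) (b := 1)); first exact: Gmeas_obs_loss.
by move=> w; exact: obs_loss_itv.
Qed.

Lemma F_measurable t : F t `<=` measurable.
Proof. by case: pr => /(_ t)[]. Qed.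

Lemma bdmeas_inv t x a : (1 <= t <= T)%N -> a \in acts x ->
  bdmeas (F t.-1) (fun w => (plan (mu t w) x a + bias x)^-1).
Proof.
move=> tT ax; have b0 := ix_bias_gt0 wf gamma_gt0 x.
have q0 w : 0 <= plan (mu t w) x a.
  by have /andP[] := plan_itv wf (mup w tT) ax.
apply: (bdmeas_itv (a := 0) (b := (bias x)^-1)).
  apply: (GmeasV (sigF _)) => [w|]; first exact: addr_ge0 (q0 w) (ltW b0).
  by apply: (GmeasD (sigF _)); [exact: Gmeas_plan|exact: (Gmeas_cst (sigF _))].
move=> w; have qb : 0 < plan (mu t w) x a + bias x by exact: ltr_wpDl.
by rewrite invr_ge0 (ltW qb) /= lef_pV2 ?posrE // lerDr.
Qed.

Lemma bdmeas_est t x a : (1 <= t <= T)%N -> a \in acts x ->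
  bdmeas (F t) (fun w => est t w x a).
Proof.
move=> tT ax; under eq_fun do rewrite estE; apply: (bdmeasM (sigF t)).
  exact: bdmeas_obs_loss.
by apply: bdmeasS (bdmeas_inv tT ax); apply: F_pred; case/andP: tT.
Qed.

(** * Deviation of the loss estimate of one pair *)

Definition ix_dev t x a w : R := bias x * est t w x a - bias x * l t w x a.

Lemma bdmeas_ix_dev t x a : (1 <= t <= T)%N -> a \in acts x ->
  bdmeas (F t) (ix_dev t x a).
Proof.
move=> tT ax; have cb := bdmeas_cst (sigF t) (bias x).
apply: (bdmeasB (sigF t)); apply: (bdmeasM (sigF t)) => //; first exact: bdmeas_est.
by apply: bdmeasS (bdmeas_loss x a tT); apply: F_pred; case/andP: tT.
Qed.

Lemma mean_ix_dev x a : a \in acts x ->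
  mean (fun w => expR (\sum_(1 <= t < T.+1) ix_dev t x a w)) <= 1.
Proof.
move=> ax; have [FS Fmon _ _ _] := pr.
apply: (exp_supermartingale FS Fmon) => [t tT|t W tT bW W0].
  exact: bdmeas_ix_dev.
rewrite /ix_dev; under [in leLHS]eq_fun do rewrite estE.
apply: (ix_step (FS t.-1) (cond_obs_loss tT ax)) => //.
- by move=> B /(Gmeas_obs_loss x a tT) /F_measurable.
- by move=> w; exact: obs_loss_itv.
- exact: Gmeas_plan.
- by move=> w; have /andP[-> ->] := plan_itv wf (mup w tT) ax.
- exact: Gmeas_loss.
- by move=> w; exact: loss_itv.
- exact: (ix_bias_gt0 wf gamma_gt0 x).
Qed.

(** * Deviation of the estimated loss of the played policy *)

Local Notation mest t w := (@mean_est X Ac H lvl acts par R gamma (mu^~ w)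
  (p0^~ w) (pt^~ w) (rw^~ w) t).

Definition mart_dev (lam : R) t w : R :=
  lam * (mest t w - inner (mu t w) (est t w)) - (lam * H%:R) ^+ 2 / 2.

(** The played estimated loss is split into predictable weights [c] and observed losses [f] with
    conditional means [g], as [linear_step] expects. *)
Let c t (i : X * Ac) w : R :=
  plan (mu t w) i.1 i.2 / (plan (mu t w) i.1 i.2 + bias i.1).
Let f t (i : X * Ac) w : R := obs_loss t i.1 i.2 w.
Let g t (i : X * Ac) w : R := plan (mu t w) i.1 i.2 * l t w i.1 i.2.

Lemma inner_estE t w : inner (mu t w) (est t w) = \sum_(i | D i) c t i w * f t i w.
Proof.
rewrite /Defs.inner (sum_pairs acts) /=; apply: eq_bigr => i _.
by rewrite estE /c /f; ring.
Qed.

Lemma mestE t w : mest t w = \sum_(i | D i) c t i w * g t i w.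
Proof. by rewrite /mean_est (sum_pairs acts). Qed.

(** At most one pair is observed at each step, and its plan times its estimate is at most 1; the
    range is thus H rather than the number of pairs. *)
Lemma inner_est_itv t w : (1 <= t <= T)%N ->
  0 <= inner (mu t w) (est t w) <= H%:R.
Proof.
move=> tT; apply/andP; split.
  apply: sumr_ge0 => x _; apply: sumr_ge0 => a ax; apply: mulr_ge0.
    by have /andP[] := plan_itv wf (mup w tT) ax.
  apply: ix_estimator_ge0 => //; first exact: mup.
  by move=> h hH; exact: ro_itv.
rewrite /Defs.inner (sum_lvl wf) -[leRHS]mulr1 mulr_natl -[in leRHS](card_ord H).
rewrite -sumr_const; apply: ler_sum => h _.
apply: (@le_trans _ _ (\sum_(x | lvl x == h)
    (xo t h w == x)%:R * \sum_(a in acts x) (ao t h w == a)%:R)).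
  apply: ler_sum => x /eqP lx; rewrite mulr_sumr; apply: ler_sum => a ax.
  have := plan_ix_estimator_le1 wf gamma_gt0 (fun h => xo t h w) (fun h => ao t h w)
    (mup w tT) (fun h hH => ro_itv w tT hH) ax.
  rewrite /ix_estimator lx; case: (xo t h w == x) => /=; last by rewrite mulr0 mul0r.
  by case: (ao t h w == a) => /=; rewrite ?mulr0 ?mulr1.
apply: (@le_trans _ _ (\sum_(x | lvl x == h) (xo t h w == x)%:R)).
  apply: ler_sum => x _; rewrite sum_delta ler_piMr //.
  by case: (_ \in _); rewrite ?ler01 ?lexx.
by rewrite sum_delta; case: (_ == _); rewrite ?ler01 ?lexx.
Qed.

Lemma bdmeas_c t i : (1 <= t <= T)%N -> D i -> bdmeas (F t.-1) (c t i).
Proof.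
by move=> tT Di; apply: (bdmeasM (sigF _)); [exact: bdmeas_plan|exact: bdmeas_inv].
Qed.

Lemma bdmeas_g t i : (1 <= t <= T)%N -> D i -> bdmeas (F t.-1) (g t i).
Proof.
by move=> tT Di; apply: (bdmeasM (sigF _)); [exact: bdmeas_plan|exact: bdmeas_loss].
Qed.

Lemma bdmeas_mart_dev lam t : (1 <= t <= T)%N -> bdmeas (F t) (mart_dev lam t).
Proof.
move=> tT; have cst k := bdmeas_cst (sigF t) (k : R).
have up h : bdmeas (F t.-1) h -> bdmeas (F t) h.
  by apply: bdmeasS; apply: F_pred; case/andP: tT.
rewrite /mart_dev; under eq_fun do rewrite mestE inner_estE.
apply: (bdmeasB (sigF t)) => //; apply: (bdmeasM (sigF t)) => //.
apply: (bdmeasB (sigF t)); apply: (bdmeas_sum (sigF t)) => i _ Di;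
  apply: (bdmeasM (sigF t)); try exact/up/bdmeas_c; first exact/up/bdmeas_g.
exact: bdmeas_obs_loss.
Qed.

Lemma mean_mart_dev lam : 0 <= lam ->
  mean (fun w => expR (\sum_(1 <= t < T.+1) mart_dev lam t w)) <= 1.
Proof.
move=> lam0; have [FS Fmon _ _ _] := pr.
apply: (exp_supermartingale FS Fmon) => [t tT|t W tT bW W0].
  exact: bdmeas_mart_dev.
rewrite /mart_dev; under [in leLHS]eq_fun do rewrite mestE inner_estE.
apply: (@linear_step _ _ _ _ _ D _ (c t) (f t) (g t) _ _ _ (FS t.-1)) => //.
- by move=> i Di; exact: cond_obs_loss.
- by move=> i Di; exact: bdmeas_c.
- by move=> i Di; apply: bdmeasS (@F_measurable t) _; exact: bdmeas_obs_loss.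
- by move=> i Di; exact: bdmeas_g.
- by move=> w; rewrite -inner_estE; exact: inner_est_itv.
Qed.

(* Instead of a union bound, Markov's inequality is applied once to the sum of
   all the exponential supermartingales. *)
Lemma good_event (delta lam : R) : 0 < delta -> 0 < lam -> 1 <= AX ->
  let iota := ln (3 * AX / delta) in
  exists E, [/\ measurable E, ((1 - delta)%:E <= P E)%E & forall w, E w ->
    (forall x a, a \in acts x ->
       \sum_(1 <= t < T.+1) est t w x a <=
       \sum_(1 <= t < T.+1) l t w x a + iota / bias x) /\
    \sum_(1 <= t < T.+1) (mest t w - inner (mu t w) (est t w)) <=
      iota / lam + T%:R * (lam * H%:R ^+ 2 / 2)].
Proof.
move=> d0 lam0 AX1 iota; have sM := measurable_sigma Omega.
pose S (i : X * Ac) w := \sum_(1 <= t < T.+1) ix_dev t i.1 i.2 w.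
pose S0 w := \sum_(1 <= t < T.+1) mart_dev lam t w.
pose M w := \sum_(i | D i) expR (S i w) + expR (S0 w).
have tT t : t \in index_iota 1 T.+1 -> (1 <= t <= T)%N.
  by rewrite mem_index_iota.
have bS i : D i -> bdmeas measurable (fun w => expR (S i w)).
  move=> Di; apply: (bdmeas_expR sM); apply: (bdmeas_sum sM) => t /tT tT' _.
  by apply: bdmeasS (@F_measurable t) _; exact: bdmeas_ix_dev.
have bS0 : bdmeas measurable (fun w => expR (S0 w)).
  apply: (bdmeas_expR sM); apply: (bdmeas_sum sM) => t /tT tT' _.
  by apply: bdmeasS (@F_measurable t) _; exact: bdmeas_mart_dev.
have bsum : bdmeas measurable (fun w => \sum_(i | D i) expR (S i w)).
  by apply: (bdmeas_sum sM) => i _; exact: bS.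
have bM : bdmeas measurable M by exact: (bdmeasD sM).
have M0 w : 0 <= M w.
  by rewrite addr_ge0 ?expR_ge0 // sumr_ge0 // => i _; exact: expR_ge0.
have AX0 : 0 < AX by exact: lt_le_trans ltr01 AX1.
have k0 : 0 < 3 * AX / delta by rewrite divr_gt0 // mulr_gt0.
exists [set w | M w < 3 * AX / delta]; split.
- by apply: (Gmeas_lt sM); [exact: bM.1|exact: (Gmeas_cst sM)].
- apply: (le_trans _ (markov_mean P k0 bM M0)); rewrite lee_fin lerD2l lerN2.
  (* One unit for each of the AX pairs and one for the played policy. *)
  have mM : mean M <= AX + 1.
    rewrite /M meanD // mean_sum; last by move=> i _; exact: bS.
    apply: lerD; last exact: mean_mart_dev (ltW lam0).
    rewrite /Defs.AX; under [leRHS]eq_bigr do rewrite -sum1_card natr_sum.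
    rewrite (sum_pairs acts) /=; apply: ler_sum => i Di; exact: mean_ix_dev.
  (* The factor 3 inside [iota] leaves room: AX + 1 <= 3 AX because AX >= 1. *)
  rewrite ler_pdivrMr // mulrCA divff ?lt0r_neq0 // mulr1.
  by apply: (le_trans mM); lra.
move=> w /= Mw.
have lnle (s : R) : expR s <= M w -> s <= iota.
  move=> sM'; rewrite -[s]expRK ler_ln ?posrE ?expR_gt0 //.
  exact: ltW (le_lt_trans sM' Mw).
split=> [x a ax|].
  have b0 := ix_bias_gt0 wf gamma_gt0 x.
  have SM : expR (S (x, a) w) <= M w.
    rewrite /M (bigD1 (x, a)) //= -addrA lerDl addr_ge0 ?expR_ge0 //.
    by rewrite sumr_ge0 // => i _; exact: expR_ge0.
  have := lnle _ SM.
  rewrite /S /ix_dev sumrB -!mulr_sumr /= -mulrBr mulrC -ler_pdivlMr //.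
  by rewrite lerBlDl.
have S0M : expR (S0 w) <= M w.
  by rewrite /M lerDr sumr_ge0 // => i _; exact: expR_ge0.
have := lnle _ S0M.
rewrite /S0 /mart_dev sumrB -mulr_sumr sum_episodes_cst lerBlDr mulrC -ler_pdivlMr //.
congr (_ <= _); field; exact: lt0r_neq0.
Qed.

End Concentration.

(** * Tuning of the parameters *)

Section Numerics.
Context (R : realType).

Let r : R := Num.sqrt 2.

Lemma sqrt2_itv : 0 < r <= 3 / 2.
Proof.
rewrite sqrtr_gt0 ltr0n /= -[leRHS]ger0_norm // -sqrtr_sqr ler_wsqrtr //.
by lra.
Qed.

Lemma sqr_sqrt2 : r * r = 2.
Proof. by rewrite -expr2 sqr_sqrtr. Qed.

(** The worst case is A = 2, with ratio 1 / r and total 1 / (1 - 1 / r) = 2 + r. The induction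
    carries the exact partial sum; dropping the first step leaves the sum for the shorter
    horizon. *)
Lemma sum_inv_sqrt_geom (A H : nat) : (2 <= A)%N ->
  \sum_(h < H) (Num.sqrt ((A ^ (H - h.+1))%:R : R))^-1 <= 2 + r.
Proof.
move=> A2; have /andP[r0 r1] := sqrt2_itv; have r2 := sqr_sqrt2.
have rV0 : 0 < r^-1 by rewrite invr_gt0.
suff : \sum_(h < H) (Num.sqrt ((A ^ (H - h.+1))%:R : R))^-1 <=
    (2 + r) * (1 - r^-1 ^+ H).
  move=> h; apply: (le_trans h); rewrite ler_piMr ?addr_ge0 ?(ltW r0) //.
  by rewrite lerBlDr lerDl exprn_ge0 // ltW.
elim: H => [|H IH]; first by rewrite big_ord0 expr0 subrr mulr0.
rewrite big_ord_recl /= subSS subn0.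
under eq_bigr do rewrite /bump /= add1n subSS.
have h1 : (Num.sqrt ((A ^ H)%:R : R))^-1 <= r^-1 ^+ H.
  rewrite exprVn lef_pV2 ?posrE ?exprn_gt0 ?sqrtr_gt0 ?ltr0n ?expn_gt0 //; last first.
    by rewrite (leq_trans _ A2).
  rewrite -[leLHS]ger0_norm ?exprn_ge0 ?(ltW r0) // -sqrtr_sqr ler_wsqrtr //.
  rewrite -exprM mulnC exprM expr2 r2 -natrX ler_nat.
  by case: (H) => // n; rewrite leq_exp2r.
apply: (le_trans (lerD h1 IH)); rewrite exprS.
have -> : r^-1 = r / 2 by apply: (mulfI (lt0r_neq0 r0)); rewrite divff ?lt0r_neq0 // mulrA r2 divff.
move: (_ ^+ H) => q.
rewrite le_eqVlt; apply/orP; left; apply/eqP.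
transitivity ((2 + r) * (1 - q) + q * (2 - r * r / 2)); [rewrite r2|]; by field.
Qed.

(** Equivalent to sqrt 2 * H <= 3/2 * sqrt (2 ^ H), with equality at H = 3. *)
Lemma sqr_le_exp2 (H : nat) : (8 * H ^ 2 <= 9 * 2 ^ H)%N.
Proof.
case: H => [|[|[|H]]] //; elim: H => // H IH.
rewrite (expnS 2) -!mulnn; move: (2 ^ _)%N IH => q; rewrite -!mulnn; nia.
Qed.

Lemma ln2_ge : 1 / 2 <= ln (2 : R).
Proof.
rewrite -ler_expR lnK ?posrE //; have := expR_ge1Dx (- (1 / 2) : R).
rewrite expRN -[(expR _)^-1]div1r ler_pdivlMr ?expR_gt0 //; lra.
Qed.

(** Since AX >= 2, [iota] is at least ln 6, and 8/5 is enough for the final constant 8. The proof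
    combines e^(1/10) <= 10/9 with (10/9)^16 <= 6. *)
Lemma ln6_ge : 8 / 5 <= ln (6 : R).
Proof.
rewrite -ler_expR lnK ?posrE //.
have -> : 8 / 5 = 16%:R * (1 / 10) :> R by lra.
rewrite expRM_natl; have := expR_ge1Dx (- (1 / 10) : R).
have e0 := expR_gt0 (1 / 10 : R); rewrite expRN -[(expR _)^-1]div1r ler_pdivlMr // => h.
have {}h : expR (1 / 10 : R) <= 10 / 9 by lra.
apply: le_trans (lerXn2r 16 _ _ h) _; rewrite ?nnegrE ?(ltW e0) ?divr_ge0 //.
by lra.
Qed.

Lemma le_horizon (H : nat) (a : R) : (2 ^ H)%:R <= a -> H%:R <= 2 * ln a.
Proof.
move=> Ha; have p0 : 0 < (2 ^ H)%:R :> R by rewrite ltr0n expn_gt0.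
have : ln ((2 ^ H)%:R : R) <= ln a by rewrite ler_ln ?posrE // (lt_le_trans p0).
rewrite natrX lnXn // -[_ *+ H]mulr_natl; have := ler_wpM2l (ler0n R H) ln2_ge; lra.
Qed.


(* lam minimizes iota / lam + T lam H^2 / 2. *)
Lemma tuned_bound (A H T : nat) (a iota lam : R) (eta gamma : nat -> R) :
  (2 <= A)%N -> (0 < H)%N -> (0 < T)%N -> (2 ^ H)%:R <= a -> a <= T%:R ->
  8 / 5 <= iota -> ln a <= iota ->
  lam = Num.sqrt 2 * Num.sqrt iota / (H%:R * Num.sqrt T%:R) ->
  (forall h, gamma h = Num.sqrt ((A ^ (H - h.+1))%:R * iota / (2 * a * T%:R))) ->
  (forall h, eta h = Num.sqrt (2 * (A ^ (H - h.+1))%:R * ln a / (a * T%:R))) ->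
  T%:R * (\sum_(h < H) gamma h * (a / (A ^ (H - h.+1))%:R)) +
    (iota / lam + T%:R * (lam * H%:R ^+ 2 / 2)) +
    \sum_(h < H) iota / gamma h +
  (ln a * (\sum_(h < H) (eta h)^-1) +
   T%:R * (\sum_(h < H) eta h / 2 * (a / (A ^ (H - h.+1))%:R)) +
   a * (Num.sqrt (ln a) * Num.sqrt iota)) <=
  (5 * Num.sqrt (ln a) + 8 * iota) * Num.sqrt (a * T%:R).
Proof.
move=> A2 H0 T0 Ha aT io lnio lamE gammaE etaE.
have a2 : 2 <= a by apply: le_trans Ha; rewrite -{1}(expn1 2) ler_nat leq_exp2l.
have a0 : 0 < a by apply: lt_le_trans a2.
have lna0 : 0 < ln a by apply: ln_gt0; apply: lt_le_trans a2; rewrite ltr1n.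
have io0 : 0 < iota by lra.
have Tr0 : 0 < T%:R :> R by rewrite ltr0n.
have Hr0 : 0 < H%:R :> R by rewrite ltr0n.
have /andP[r0 r1] := sqrt2_itv; have r2 := sqr_sqrt2.
set L := Num.sqrt (ln a); set I := Num.sqrt iota.
pose at_ := Num.sqrt a; pose Tt := Num.sqrt (T%:R : R).
have SE : Num.sqrt (a * T%:R) = at_ * Tt by rewrite sqrtrM // ltW.
have sq (x : R) : 0 < x -> 0 < Num.sqrt x /\ Num.sqrt x * Num.sqrt x = x.
  by move=> x0; rewrite sqrtr_gt0 -expr2 sqr_sqrtr // ltW.
have [L0 LL] := sq _ lna0; have [I0 II] := sq _ io0.
have [at0 aa] := sq _ a0; have [Tt0 TT] := sq _ Tr0.
rewrite -/L -/I -/at_ -/Tt in L0 LL I0 II at0 aa Tt0 TT.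
pose be h := Num.sqrt ((A ^ (H - h.+1))%:R : R).
have beP h : 0 < be h /\ be h * be h = (A ^ (H - h.+1))%:R.
  by apply: sq; rewrite ltr0n expn_gt0 (leq_trans _ A2).
have dE : Num.sqrt (2 * a * T%:R) = r * (at_ * Tt) by rewrite -mulrA sqrtrM // SE.
have {}gammaE h : gamma h = be h * (I / (r * (at_ * Tt))).
  rewrite gammaE sqrtrM ?mulr_ge0 ?ler0n ?(ltW io0) // sqrtrM ?ler0n //.
  by rewrite sqrtrV ?mulr_ge0 ?(ltW a0) // dE -mulrA.
have {}etaE h : eta h = be h * (r * L / (at_ * Tt)).
  rewrite etaE sqrtrM ?mulr_ge0 ?ler0n ?(ltW lna0) // sqrtrM ?mulr_ge0 ?ler0n //.
  rewrite sqrtrV ?mulr_ge0 ?(ltW a0) // SE sqrtrM //.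
  by rewrite -/(be h) -/L -/r [r * be h]mulrC !mulrA.
rewrite SE.
pose G := \sum_(h < H) (be h)^-1.
have G2 : G <= 2 + r by exact: sum_inv_sqrt_geom.
have sumE (k : nat -> R) (z : R) : (forall h, k h = z / be h) ->
    \sum_(h < H) k h = z * G.
  by move=> kE; rewrite mulr_sumr; apply: eq_bigr => h _; rewrite kE.
have nz : [/\ r != 0, at_ != 0, Tt != 0, L != 0 & I != 0] by split; exact: lt0r_neq0.
have [rn an Tn Ln In] := nz.
have bn h : be h != 0 by apply: lt0r_neq0; case: (beP h).
have Hn : H%:R != 0 :> R by exact: lt0r_neq0.
have e1 : \sum_(h < H) gamma h * (a / (A ^ (H - h.+1))%:R) = I * at_ / (r * Tt) * G.
  apply: (sumE (fun h => _ h * (_ / (A ^ (H - h.+1))%:R))) => h.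
  by rewrite gammaE -(beP h).2 -aa; field; rewrite bn rn Tn an.
have e2 : \sum_(h < H) iota / gamma h = r * I * at_ * Tt * G.
  apply: (sumE (fun h => _ / gamma h)) => h.
  by rewrite gammaE -II; field; rewrite In Tn an rn bn.
have e3 : \sum_(h < H) (eta h)^-1 = at_ * Tt / (r * L) * G.
  apply: (sumE (fun h => (eta h)^-1)) => h.
  by rewrite etaE; field; rewrite Ln rn Tn an bn.
have e4 : \sum_(h < H) eta h / 2 * (a / (A ^ (H - h.+1))%:R) =
    r * L * at_ / (2 * Tt) * G.
  apply: (sumE (fun h => _ h / 2 * (_ / (A ^ (H - h.+1))%:R))) => h.
  by rewrite etaE -(beP h).2 -aa; field; rewrite bn Tn an.
have e5 : iota / lam + T%:R * (lam * H%:R ^+ 2 / 2) = r * I * H%:R * Tt.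
  rewrite lamE -/r -/I -/Tt -II -TT.
  transitivity ((2 / r + r) / 2 * I * H%:R * Tt); first by field; rewrite Tn Hn In rn.
  by rewrite -{1}r2; field.
(* The martingale term carries H in place of a geometric sum; H is absorbed by sqrt a >= 2^(H/2). *)
have rH : r * H%:R <= 3 / 2 * at_.
  rewrite -ler_sqr ?nnegrE ?mulr_ge0 ?(ltW r0) ?(ltW at0) // !exprMn.
  rewrite !(expr2 r, expr2 at_) r2 aa -natrX.
  have : (8 * H ^ 2)%:R <= (9 * 2 ^ H)%:R :> R by rewrite ler_nat sqr_le_exp2.
  rewrite !natrM; lra.
rewrite e1 e2 e3 e4 e5 -TT -{1}LL.
set S := at_ * Tt.
have S0 : 0 < S by exact: mulr_gt0.
have f1 : Tt * Tt * (I * at_ / (r * Tt) * G) = S * I * (G / r).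
  by rewrite /S; field; rewrite Tn rn.
have f3 : L * L * (S / (r * L) * G) = S * L * (G / r).
  by field; rewrite Ln rn.
have f4 : Tt * Tt * (r * L * at_ / (2 * Tt) * G) = S * L * (G * r / 2).
  by rewrite /S; field; rewrite Tn.
have GrE : G / r = G * r / 2.
  by apply: (mulfI rn); rewrite mulrCA divff // mulr1 mulrA mulrCA -mulrA r2; field.
have Gr : G * r / 2 <= r + 1.
  have : G * r <= (2 + r) * r by rewrite ler_pM2r.
  rewrite mulrDl r2; lra.
have -> : r * I * at_ * Tt * G = S * I * (G * r) by rewrite /S; ring.
rewrite f1 f3 f4 GrE.
have SI0 : 0 < S * I by exact: mulr_gt0.
have SL0 : 0 < S * L by exact: mulr_gt0.
(* In units of S I, bias and comparator cost G / r + G r <= 3 (r + 1); in units of S L, entropy and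
   stability cost at most 2 (r + 1). *)
have g1 := ler_wpM2l (ltW SI0) Gr.
have g2 := ler_wpM2l (ltW SL0) Gr.
have g3 : r * I * H%:R * Tt <= S * I * (3 / 2).
  rewrite (_ : r * I * _ * _ = r * H%:R * (I * Tt)); last by ring.
  rewrite (_ : S * I * _ = 3 / 2 * at_ * (I * Tt)); last by rewrite /S; ring.
  by rewrite ler_wpM2r // mulr_ge0 // ltW.
(* Here a <= T gives a <= sqrt a * sqrt T, and ln a <= iota gives L <= I. *)
have g4 : a * (L * I) <= S * iota.
  apply: ler_pM; rewrite ?mulr_ge0 ?(ltW a0) ?(ltW L0) ?(ltW I0) //.
    by rewrite -aa /S ler_wpM2l ?(ltW at0) // ler_wsqrtr.
  by rewrite -II ler_wpM2r ?(ltW I0) // ler_wsqrtr.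
(* Rational bounds on I and r fine enough for 3 (r + 1) + 3/2 <= 7 I and 2 (r + 1) <= 5; the term of
   [g4] raises 7 to 8. *)
have I1 : 63 / 50 <= I.
  rewrite -[leLHS]ger0_norm // -sqrtr_sqr ler_wsqrtr //; lra.
have r3 : r <= 71 / 50.
  rewrite -ler_sqr ?nnegrE ?(ltW r0) // expr2 r2; lra.
have g5 : S * I * (3 * (r + 1) + 3 / 2) <= 7 * (S * iota).
  rewrite -II (_ : 7 * _ = S * I * (7 * I)); last by ring.
  rewrite ler_wpM2l ?(ltW SI0) //; lra.
have g6 : S * L * (2 * (r + 1)) <= S * L * 5 by rewrite ler_wpM2l ?(ltW SL0) //; lra.
lra.
Qed.

(** In the ratio eta / (2 gamma) the level and the number of episodes cancel, leaving sqrt (ln a /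
    iota). *)
Lemma tuned_ratio (B a iota t : R) : 0 < B -> 0 < a -> 0 < iota -> 0 < t ->
  0 <= ln a ->
  Num.sqrt (2 * B * ln a / (a * t)) / (2 * Num.sqrt (B * iota / (2 * a * t))) * iota
  = Num.sqrt (ln a) * Num.sqrt iota.
Proof.
move=> B0 a0 io0 t0 l0; set g := B * iota / (2 * a * t).
have g0 : 0 < g by rewrite /g divr_gt0 ?mulr_gt0.
have -> : 2 * B * ln a / (a * t) = 2 ^+ 2 * (ln a * iota^-1 * g).
  by rewrite /g; field; rewrite !lt0r_neq0.
rewrite sqrtrM // sqrtr_sqr normr_nat sqrtrM ?mulr_ge0 ?invr_ge0 ?(ltW io0) //.
rewrite sqrtrM // sqrtrV ?(ltW io0) //.
have I0 : Num.sqrt iota != 0 by rewrite lt0r_neq0 // sqrtr_gt0.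
have sg0 : Num.sqrt g != 0 by rewrite lt0r_neq0 // sqrtr_gt0.
rewrite -[X in _ * X = _](sqr_sqrtr (ltW io0)).
by field; rewrite sg0 I0.
Qed.

End Numerics.

(** On each level reach * plan is a probability distribution and losses are at most reach, so the
    policy [m] loses at most 1 per step; the comparator's loss is nonnegative. *)
Lemma regret_le_horizon (X Ac : finType) (H : nat) (lvl : X -> nat)
    (acts : X -> {set Ac}) (par : X -> option (X * Ac)) (R : realType)
    (m m' : X -> Ac -> R) p0 pt rw :
  efg_wf H lvl acts par -> env_wf H lvl acts par p0 pt rw ->
  is_policy acts m -> is_policy acts m' ->
  inner H acts par m (loss H par p0 pt rw) - inner H acts par m' (loss H par p0 pt rw)
  <= H%:R.
Proof.
move=> wf ewf mp mp'; have [_ p01 _ pt1 w01] := ewf.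
have l0 x a : 0 <= loss H par p0 pt rw x a <= reach H par p0 pt x.
  have /andP[r0 _] := reach_itv wf x ewf; have /andP[w0 w1] := w01 x a.
  by rewrite /loss mulr_ge0 ?subr_ge0 //= ler_piMr // lerBlDr lerDl.
have i0 : 0 <= inner H acts par m' (loss H par p0 pt rw).
  apply: sumr_ge0 => x _; apply: sumr_ge0 => a ax; apply: mulr_ge0.
    by have /andP[] := plan_itv wf mp' ax.
  by have /andP[] := l0 x a.
rewrite lerBlDr (le_trans _ (_ : H%:R <= _)) ?lerDl //.
rewrite /inner (sum_lvl wf) -[leRHS]mulr1 mulr_natl -[in leRHS](card_ord H).
rewrite -sumr_const; apply: ler_sum => h _.
rewrite -(flow_plan wf mp p01 pt1 (ltn_ord h)).
apply: ler_sum => x _; apply: ler_sum => a ax; rewrite mulrC ler_wpM2r //.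
  by have /andP[] := plan_itv wf mp ax.
by have /andP[] := l0 x a.
Qed.

Unset Implicit Arguments.

Theorem theorem4
  (X Ac : finType) (H : nat) (lvl : X -> nat) (acts : X -> {set Ac})
  (par : X -> option (X * Ac))
  (R : realType) (d : measure_display) (Omega : measurableType d)
  (P : probability Omega R)
  (A T : nat) (delta : R)
  (F : nat -> set (set Omega))
  (mu : nat -> Omega -> X -> Ac -> R)
  (p0 : nat -> Omega -> X -> R) (pt : nat -> Omega -> X -> Ac -> X -> R)
  (rw : nat -> Omega -> X -> Ac -> R)
  (xo : nat -> nat -> Omega -> X) (ao : nat -> nat -> Omega -> Ac)
  (ro : nat -> nat -> Omega -> R) :
  efg_wf H lvl acts par ->
  (2 <= A)%N ->
  (forall x, #|acts x| = A) ->
  0 < delta < 1 ->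
  let AXr := AX acts R in
  let iota := ln (3 * AXr / delta) in
  let gamma := fun h : nat =>
    Num.sqrt ((A ^ (H - h.+1))%:R * iota / (2 * AXr * T%:R)) in
  let eta := fun h : nat =>
    Num.sqrt (2 * (A ^ (H - h.+1))%:R * ln AXr / (AXr * T%:R)) in
  protocol H lvl acts par P T F mu p0 pt rw xo ao ro ->
  (forall w, balanced_ftrl H lvl acts par T eta gamma
               (fun t => mu t w) (fun t h => xo t h w) (fun t h => ao t h w)
               (fun t h => ro t h w)) ->
  exists E : set Omega,
    [/\ measurable E, (P E >= (1 - delta)%:E)%E &
        forall w, E w ->
          forall mud : X -> Ac -> R, is_policy acts mud ->
            \sum_(1 <= t < T.+1)
               (inner H acts par (mu t w) (loss H par (p0 t w) (pt t w) (rw t w))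
                - inner H acts par mud (loss H par (p0 t w) (pt t w) (rw t w)))
            <= (5 * Num.sqrt (ln AXr) + 8 * iota) * Num.sqrt (AXr * T%:R)].
Proof.
move=> wf A2 actsA /andP[d0 d1] AXr iota gamma eta pr ftrl.
(* A sample point provides an information set, so the tree is nonempty. *)
have x0 : X := xo 0%N 0%N point.
have H0 : (0 < H)%N by apply: leq_trans (lvl_lt wf x0).
have Ha : (2 ^ H)%:R <= AXr.
  apply: le_trans (AX_ge R wf actsA x0); rewrite ler_nat.
  by case: (H) => // n; rewrite leq_exp2r.
have a2 : 2 <= AXr by apply: le_trans Ha; rewrite -{1}(expn1 2) ler_nat leq_exp2l.
have a0 : 0 < AXr by apply: lt_le_trans a2.
have a3d : 3 * AXr <= 3 * AXr / delta.
  by rewrite ler_pdivlMr // ler_piMr ?mulr_ge0 // ltW.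
have lna0 : 0 < ln AXr by apply: ln_gt0; apply: lt_le_trans a2; rewrite ltr1n.
have io : 8 / 5 <= iota.
  apply: le_trans (ln6_ge R) _; rewrite ler_ln ?posrE //; last first.
    by rewrite divr_gt0 // mulr_gt0.
  by apply: le_trans a3d; lra.
have lnio : ln AXr <= iota.
  rewrite ler_ln ?posrE //; last by rewrite divr_gt0 // mulr_gt0.
  by apply: le_trans a3d; lra.
have io0 : 0 < iota by lra.
have rhs0 : 0 <= (5 * Num.sqrt (ln AXr) + 8 * iota) * Num.sqrt (AXr * T%:R).
  by rewrite mulr_ge0 ?sqrtr_ge0 // addr_ge0 ?mulr_ge0 ?sqrtr_ge0 // ltW.
have PT : ((1 - delta)%:E <= P [set: Omega])%E.
  by rewrite probability_setT lee_fin lerBlDr lerDl ltW.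
have [->|T0] := posnP T.
  exists [set: Omega]; split=> // w _ mud _; rewrite big_geq //.
  by rewrite mulr0 sqrtr0 mulr0.
have Tr0 : 0 < T%:R :> R by rewrite ltr0n.
have mup t w : (1 <= t <= T)%N -> is_policy acts (mu t w) by case/(ftrl w).
have [Ta|aT] := ltrP T%:R AXr.
  exists [set: Omega]; split=> // w _ mud mudp.
  apply: (@le_trans _ _ (\sum_(1 <= t < T.+1) H%:R)).
    rewrite !big_nat; apply: ler_sum => t tT.
    exact: (regret_le_horizon wf (env_wfP pr w tT) (mup t w tT) mudp).
  rewrite sum_episodes_cst.
  (* In this regime T <= sqrt (AX * T), while H <= 2 ln AX <= 2 iota. *)
  have HE := le_horizon Ha.
  have TE : T%:R <= Num.sqrt (AXr * T%:R).
    rewrite -[leLHS]ger0_norm // -sqrtr_sqr ler_wsqrtr // expr2.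
    by rewrite ler_pM2r // ltW.
  rewrite mulrC; apply: ler_pM => //.
  by have := sqrtr_ge0 (ln AXr); lra.
have A0 h : 0 < (A ^ (H - h.+1))%:R :> R.
  by rewrite ltr0n expn_gt0 (leq_trans _ A2).
have gamma0 h : (h < H)%N -> 0 < gamma h.
  by move=> _; rewrite sqrtr_gt0 divr_gt0 // !mulr_gt0.
have eta0 h : (h < H)%N -> 0 < eta h.
  by move=> _; rewrite sqrtr_gt0 divr_gt0 // !mulr_gt0.
pose lam : R := Num.sqrt 2 * Num.sqrt iota / (H%:R * Num.sqrt T%:R).
have lam0 : 0 < lam.
  by rewrite divr_gt0 ?mulr_gt0 ?sqrtr_gt0 ?ltr0n.
have a1 : 1 <= AXr by lra.
have [E [mE PE EP]] := good_event wf pr mup gamma0 d0 lam0 a1.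
exists E; split=> // w Ew mud mudp.
have [ix mart] := EP w Ew.
have := regret_decomposition wf actsA T0 eta0 gamma0
  (fun t tT => env_wfP pr w tT) (fun t h tT hH => ro_itv pr w tT hH)
  (ftrl w) ix mart mudp x0.
move=> h; apply: (le_trans h).
apply: le_trans (tuned_bound A2 H0 T0 Ha aT io lnio (erefl lam) (fun=> erefl) (fun=> erefl)).
(* Only the last terms differ: the summand is the same for all pairs, and there are AX of them. *)
rewrite lerD2l lerD2l le_eqVlt; apply/orP; left; apply/eqP.
rewrite /AXr /AX mulr_suml; apply: eq_bigr => x _.
rewrite [RHS]mulr_natl -sumr_const; apply: eq_bigr => a _.
exact: (tuned_ratio (A0 _) a0 io0 Tr0 (ltW lna0)).
Qed.
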